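(* For generic limit algebras of 4-cycle algebras the limit homology group is a well-defined invariant for star extendible isomorphism. That is, if $(A_k,\alpha_k)$ and $(A'_k,\alpha'_k)$ are generic systems of 4-cycle algebras whose algebraic direct limits $A$ and $A'$ are star extendibly isomorphic, then the groups $H_1(\{A_k,\alpha_k\})$ and $H_1(\{A'_k,\alpha'_k\})$ are isomorphic.
   Context: 4-cycle algebras. For positive integers $n_1,\dots,n_4$ with $r=\sum n_i$, the 4-cycle algebra with these block sizes is the algebra $A\subseteq M_r(\mathbb C)$ of block matrices $(a_{ij})$, $a_{ij}\in M_{n_i,n_j}(\mathbb C)$, with $a_{ij}=0$ unless $i=j$ or ($i\in\{1,2\}$, $j\in\{3,4\}$). $Q_1,\dots,Q_4$ denote the block projections. $C^*(A)=M_r(\mathbb C)$. An embedding (injective homomorphism) $\phi:A\to A'$ is star extendible if it extends to a $*$-homomorphism $C^*(A)\to C^*(A')$; its multiplicity is that of the extension. A multiplicity one star extendible embedding is rigid of type $\theta$ if $\theta$ is a permutation of $\{1,2,3,4\}$ preserving $\{1,2\}$ and $\{3,4\}$ and $\phi(Q_iAQ_j)\subseteq Q'_{\theta(i)}A'Q'_{\theta(j)}$ for all $i,j$ (four types: $\mathrm{id},(12),(34),(12)(34)$). A rigid embedding is a sum of multiplicity one rigid embeddings with mutually orthogonal ranges; it is generic if all four types occur. $H_1$ of a 4-cycle algebra is $\mathbb Z$, and for $\phi$ rigid $H_1(\phi)$ is multiplication by (number of summands of type $\mathrm{id}$ or $(12)(34)$) minus (number of type $(12)$ or $(34)$). A generic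 system is a direct system $(A_k,\alpha_k)$ of 4-cycle algebras with all $\alpha_k$ generic; its algebraic direct limit $A$ is a generic limit algebra. $H_1(\{A_k,\alpha_k\})=\varinjlim(H_1(A_k),H_1(\alpha_k))$. A star extendible isomorphism $A\to A'$ is an algebra isomorphism extending to a $*$-isomorphism of the generated self-adjoint algebras $\varinjlim C^*(A_k)\to\varinjlim C^*(A'_k)$ (algebraic limits). *)

(* Defs.v *)
From HB Require Import structures.
From mathcomp Require Import all_boot all_order all_algebra all_fingroup.
From mathcomp Require Import generic_quotient complex spectral.
From mathcomp Require Import boolp classical_sets reals.

Set Implicit Arguments.
Unset Strict Implicit.
Unset Printing Implicit Defensive.

Import Order.TTheory GRing.Theory Num.Theory.
Local Open Scope ring_scope.
Local Open Scope quotient_scope.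
Local Open Scope sesquilinear_scope.

Section DirectLimit.
Variables (T : nat -> choiceType) (f : forall k, T k -> T k.+1).

Definition dl_step (u : {k & T k}) : {k & T k} :=
  existT (fun k => T k) (tag u).+1 (f (tagged u)).

(* iter m dl_step u = iter p dl_step v forces m + tag u = p + tag v, so this  *)
(* says that u and v become equal at some common later stage.                 *)
Definition dl_rel (u v : {k & T k}) : bool :=
  `[< exists m p, iter m dl_step u = iter p dl_step v >].

Lemma dl_rel_refl : reflexive dl_rel.
Proof. by move=> u; apply/asboolP; exists 0%N, 0%N. Qed.

Lemma dl_rel_sym : symmetric dl_rel.
Proof. by move=> u v; apply/asboolP/asboolP => -[m [p e]]; exists p, m. Qed.

Lemma dl_rel_trans : transitive dl_rel.
Proof.
move=> v u w /asboolP[m [p e]] /asboolP[m' [p' e']]; apply/asboolP.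
exists (m' + m)%N, (p + p')%N.
by rewrite iterD e -iterD addnC iterD e' -iterD.
Qed.

Definition dl_equiv : equiv_rel {k & T k} :=
  EquivRel dl_rel dl_rel_refl dl_rel_sym dl_rel_trans.

Definition dirlim := {eq_quot dl_equiv}.
HB.instance Definition _ := Choice.on dirlim.

Definition dl_inj k (x : T k) : dirlim :=
  \pi_dirlim (existT (fun k => T k) k x).

Lemma dl_injS k (x : T k) : dl_inj (f x) = dl_inj x.
Proof. by apply/eqmodP; apply/asboolP; exists 0%N, 1%N. Qed.

Lemma dl_inj_iter m u : \pi_dirlim (iter m dl_step u) = \pi_dirlim u.
Proof. by apply/eqmodP; apply/asboolP; exists 0%N, m. Qed.

Lemma tag_iter_dl_step m u : tag (iter m dl_step u) = (m + tag u)%N.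
Proof. by elim: m => //= m ->. Qed.

Lemma dl_inj_surj (X : dirlim) : exists k (x : T k), X = dl_inj x.
Proof. by case: (repr X) (reprK X) => k x <-; exists k, x. Qed.

Lemma dl_inj_lift k l (x : T k) :
  (k <= l)%N -> exists y : T l, dl_inj y = dl_inj x.
Proof.
move=> kl; have := tag_iter_dl_step (l - k) (existT _ k x).
rewrite /= subnK //; have := dl_inj_iter (l - k) (existT _ k x).
by case: (iter _ _ _) => n y /= e en; subst n; exists y.
Qed.

(* Any two elements are represented at a common stage, which is where binary  *)
(* operations are evaluated; dl_op2E is the well-definedness.  The default    *)
(* value X of xget is never used, by dl_inj_surj2.                            *)
Definition dl_op2 (op : forall k, T k -> T k -> T k) (X Y : dirlim) : dirlim :=
  xget X [set Z | exists k (x y : T k),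
    [/\ X = dl_inj x, Y = dl_inj y & Z = dl_inj (op k x y)]]%classic.

Lemma dl_inj_surj2 (X Y : dirlim) :
  exists k (x y : T k), X = dl_inj x /\ Y = dl_inj y.
Proof.
have [k [x ->]] := dl_inj_surj X; have [l [y ->]] := dl_inj_surj Y.
have [x' <-] := dl_inj_lift x (leq_maxl k l).
have [y' <-] := dl_inj_lift y (leq_maxr k l).
by exists (maxn k l), x', y'.
Qed.

Lemma dl_inj_surj3 (X Y Z : dirlim) :
  exists k (x y z : T k), [/\ X = dl_inj x, Y = dl_inj y & Z = dl_inj z].
Proof.
have [k [x [y [-> ->]]]] := dl_inj_surj2 X Y.
have [l [z ->]] := dl_inj_surj Z.
have [x' <-] := dl_inj_lift x (leq_maxl k l).
have [y' <-] := dl_inj_lift y (leq_maxl k l).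
have [z' <-] := dl_inj_lift z (leq_maxr k l).
by exists (maxn k l), x', y', z'.
Qed.

Fixpoint dl_push m k (x : T k) : T (m + k) :=
  if m is m'.+1 then f (dl_push m' x) else x.

Lemma iter_dl_step m k (x : T k) :
  iter m dl_step (existT _ k x) = existT _ (m + k)%N (dl_push m x).
Proof. by elim: m => //= m ->. Qed.

Lemma dl_inj_push m k (x : T k) : dl_inj (dl_push m x) = dl_inj x.
Proof. by elim: m => //= m <-; rewrite dl_injS. Qed.

Lemma dl_inj_eq k l (x : T k) (y : T l) :
  dl_inj x = dl_inj y <-> exists m p,
    existT (fun k => T k) (m + k)%N (dl_push m x) =
    existT (fun k => T k) (p + l)%N (dl_push p y).
Proof.
split=> [/eqmodP/asboolP[m [p]]|[m [p e]]].
  by rewrite !iter_dl_step => e; exists m, p.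
by apply/eqmodP/asboolP; exists m, p; rewrite !iter_dl_step.
Qed.

Lemma dl_inj_eq2 k l (x x' : T k) (y y' : T l) :
  dl_inj x = dl_inj y -> dl_inj x' = dl_inj y' -> exists m p,
  existT (fun k => T k) (m + k)%N (dl_push m x) = existT _ (p + l)%N (dl_push p y)
  /\ existT (fun k => T k) (m + k)%N (dl_push m x') =
     existT _ (p + l)%N (dl_push p y').
Proof.
move=> /dl_inj_eq[m [p e]] /dl_inj_eq[m' [p' e']].
have s a m0 p0 (z : T k) (t : T l) : existT (fun k => T k) (m0 + k)%N (dl_push m0 z) =
    existT _ (p0 + l)%N (dl_push p0 t) ->
    existT (fun k => T k) (a + m0 + k)%N (dl_push (a + m0) z) =
    existT _ (a + p0 + l)%N (dl_push (a + p0) t).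
  by rewrite -!iter_dl_step !iterD => ->.
have h := s m' _ _ _ _ e; have := s m _ _ _ _ e'.
have /= t := congr1 tag e; have /= t' := congr1 tag e'.
have -> : (m + p' = m' + p)%N.
  by apply/eqP; rewrite -(eqn_add2r l) -!addnA -t -t' addnCA.
by rewrite (addnC m m') => h'; exists (m' + m)%N, (m' + p)%N.
Qed.

Lemma dl_op2E (op : forall k, T k -> T k -> T k) :
  (forall k (x y : T k), f (op k x y) = op k.+1 (f x) (f y)) ->
  forall k (x y : T k), dl_op2 op (dl_inj x) (dl_inj y) = dl_inj (op k x y).
Proof.
move=> fop k x y; rewrite /dl_op2; case: xgetP => [Z -> [l [x' [y' [ex ey ->]]]]|].
  have pop m j (a b : T j) : dl_push m (op j a b) = op _ (dl_push m a) (dl_push m b).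
    by elim: m => //= m ->; rewrite fop.
  have [m [p []]] := dl_inj_eq2 ex ey.
  rewrite -(dl_inj_push p (op l x' y')) -(dl_inj_push m (op k x y)) !pop.
  move: (dl_push m x) (dl_push m y) (dl_push p x') (dl_push p y').
  move: (m + k)%N (p + l)%N => i j a b c d eac.
  have /= ij := congr1 tag eac; subst j.
  by move=> ebd; rewrite (eq_from_Tagged eac) (eq_from_Tagged ebd).
by move=> /(_ (dl_inj (op k x y))) []; exists k, x, y.
Qed.
End DirectLimit.

(* The map of limits induced by maps g k : T k -> T' k; dl_mapE is the        *)
(* well-definedness.                                                          *)
Definition dl_map (T T' : nat -> choiceType) (f : forall k, T k -> T k.+1)
    (f' : forall k, T' k -> T' k.+1) (g : forall k, T k -> T' k)
    (X : dirlim f) : dirlim f' :=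
  dl_inj f' (g _ (tagged (repr X))).

Lemma dl_mapE (T T' : nat -> choiceType) (f : forall k, T k -> T k.+1)
    (f' : forall k, T' k -> T' k.+1) (g : forall k, T k -> T' k) :
  (forall k (x : T k), g k.+1 (f k x) = f' k (g k x)) ->
  forall k (x : T k), dl_map f' g (dl_inj f x) = dl_inj f' (g k x).
Proof.
move=> gf k x; rewrite /dl_map; case: repr (reprK (dl_inj f x)) => l y /= e.
have pg m j (a : T j) : g _ (dl_push f m a) = dl_push f' m (g _ a).
  by elim: m => //= m <-; rewrite gf.
have [m [p]] := (dl_inj_eq f y x).1 e.
rewrite -(dl_inj_push f' m (g l y)) -(dl_inj_push f' p (g k x)) -!pg.
move: (dl_push f m y) (dl_push f p x); move: (m + l)%N (p + k)%N => i j a b eab.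
have /= ij := congr1 tag eab; subst j.
by rewrite (eq_from_Tagged eab).
Qed.

Section ZmodLimit.
Variables (T : nat -> zmodType) (f : forall k, {additive T k -> T k.+1}).

Definition zlim := @dirlim (fun k => T k) (fun k => f k).
HB.instance Definition _ := Choice.on zlim.

Definition zlim_inj k (x : T k) : zlim := @dl_inj (fun k => T k) (fun k => f k) k x.
Definition zlim0 : zlim := zlim_inj (0 : T 0).
Definition zlim_opp : zlim -> zlim :=
  @dl_map (fun k => T k) (fun k => T k) _ _ (fun k x => - x).
Definition zlim_add : zlim -> zlim -> zlim :=
  @dl_op2 (fun k => T k) _ (fun k x y => x + y).

Lemma zlim_addE k (x y : T k) :
  zlim_add (zlim_inj x) (zlim_inj y) = zlim_inj (x + y).
Proof. by rewrite /zlim_add /zlim_inj dl_op2E// => *; rewrite raddfD. Qed.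

Lemma zlim_oppE k (x : T k) : zlim_opp (zlim_inj x) = zlim_inj (- x).
Proof. by rewrite /zlim_opp /zlim_inj dl_mapE// => *; rewrite raddfN. Qed.

Lemma zlim0E k : zlim0 = zlim_inj (0 : T k).
Proof.
elim: k => // k ->; rewrite -(raddf0 (f k)).
exact/esym/(@dl_injS (fun k => T k) (fun k => f k)).
Qed.

Lemma zlim_addA : associative zlim_add.
Proof.
move=> X Y Z; have [k [x [y [z [-> -> ->]]]]] := dl_inj_surj3 X Y Z.
by rewrite -!/(zlim_inj _) !zlim_addE addrA.
Qed.

Lemma zlim_addC : commutative zlim_add.
Proof.
move=> X Y; have [k [x [y [-> ->]]]] := dl_inj_surj2 X Y.
by rewrite -!/(zlim_inj _) !zlim_addE addrC.
Qed.

Lemma zlim_add0 : left_id zlim0 zlim_add.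
Proof.
move=> X; have [k [x ->]] := dl_inj_surj X.
by rewrite -!/(zlim_inj _) (zlim0E k) zlim_addE add0r.
Qed.

Lemma zlim_addN : left_inverse zlim0 zlim_opp zlim_add.
Proof.
move=> X; have [k [x ->]] := dl_inj_surj X.
by rewrite -!/(zlim_inj _) zlim_oppE zlim_addE addNr -zlim0E.
Qed.

HB.instance Definition _ :=
  GRing.isZmodule.Build zlim zlim_addA zlim_addC zlim_add0 zlim_addN.
End ZmodLimit.

Section LmodLimit.
Variables (K : pzRingType) (T : nat -> lmodType K).
Variable f : forall k, {linear T k -> T k.+1}.

Definition llim := @zlim (fun k => T k) (fun k => f k).
HB.instance Definition _ := GRing.Zmodule.on llim.

Definition llim_inj k (x : T k) : llim := @zlim_inj (fun k => T k) (fun k => f k) k x.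
Definition llim_scale (a : K) : llim -> llim :=
  @dl_map (fun k => T k) (fun k => T k) _ _ (fun k x => a *: x).

Lemma llim_scaleE a k (x : T k) : llim_scale a (llim_inj x) = llim_inj (a *: x).
Proof.
by rewrite /llim_scale /llim_inj /zlim_inj dl_mapE// => j y; apply/esym; exact: (linearZZ (f j) a y).
Qed.

Lemma llim_addE k (x y : T k) : llim_inj x + llim_inj y = llim_inj (x + y).
Proof. exact: (@zlim_addE (fun k => T k) (fun k => f k)). Qed.

Lemma llim_scaleA a b X : llim_scale a (llim_scale b X) = llim_scale (a * b) X.
Proof.
have [k [x ->]] := dl_inj_surj X.
by rewrite -!/(zlim_inj _ _) -!/(llim_inj _) !llim_scaleE scalerA.
Qed.

Lemma llim_scale1 : left_id 1 llim_scale.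
Proof.
move=> X; have [k [x ->]] := dl_inj_surj X.
by rewrite -!/(zlim_inj _ _) -!/(llim_inj _) !llim_scaleE scale1r.
Qed.

Lemma llim_scaleDr : right_distributive llim_scale +%R.
Proof.
move=> a X Y; have [k [x [y [-> ->]]]] := dl_inj_surj2 X Y.
by rewrite -!/(zlim_inj _ _) -!/(llim_inj _) !(llim_addE, llim_scaleE) scalerDr.
Qed.

Lemma llim_scaleDl X : {morph llim_scale^~ X : a b / a + b}.
Proof.
move=> a b; have [k [x ->]] := dl_inj_surj X.
by rewrite -!/(zlim_inj _ _) -!/(llim_inj _) !(llim_addE, llim_scaleE) scalerDl.
Qed.

HB.instance Definition _ :=
  GRing.Zmodule_isLmodule.Build K llim llim_scaleA llim_scale1 llim_scaleDr
    llim_scaleDl.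
End LmodLimit.

(* Blocks 1, 2, 3, 4 are numbered 0, 1, 2, 3 in 'I_4.                         *)
Definition arrow (i j : 'I_4) : bool := (i == j) || ((i < 2) && (2 <= j))%N.

Lemma arrow_refl i : arrow i i.
Proof. by rewrite /arrow eqxx. Qed.

Lemma arrow_trans i j k : arrow i j -> arrow j k -> arrow i k.
Proof.
rewrite /arrow => /orP[/eqP->//|/andP[i2 j2]] /orP[/eqP<-|/andP[]].
  by rewrite i2 j2 orbT.
by rewrite ltnNge j2.
Qed.

Section FourCycleAlgebra.
Variables (R : realType) (n : 'I_4 -> nat).

(* The ambient matrix algebra, i.e. C*(A).                                    *)
Definition cstar := 'M[R[i]]_(\sum_i n i).
HB.instance Definition _ := GRing.PzRing.on cstar.
HB.instance Definition _ := GRing.Lmodule.on cstar.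

Definition fc_pred : {pred cstar} :=
  [pred x : cstar | [forall i, forall j, arrow i j || (submxblock x i j == 0)]].

Record fcalg := FCAlg { fc_val :> cstar; fc_valP : fc_val \in fc_pred }.
HB.instance Definition _ := [isSub for fc_val].
HB.instance Definition _ := [Choice of fcalg by <:].

Lemma fc_predP (x : cstar) :
  reflect (forall i j, ~~ arrow i j -> submxblock x i j = 0) (x \in fc_pred).
Proof.
apply: (iffP forallP) => [h i j /negPf nij|h i].
  by have /forallP/(_ j) := h i; rewrite nij => /eqP.
by apply/forallP => j; case: (boolP (arrow i j)) => //= /h ->.
Qed.

Lemma fc_subring_closed : subring_closed fc_pred.
Proof.
split=> [|x y /fc_predP hx /fc_predP hy|x y /fc_predP hx /fc_predP hy].
- apply/fc_predP => i j nij; have -> : (1 : cstar) = \mxdiag_(i < 4) 1%:M.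
    by rewrite mxdiagZ.
  rewrite /mxdiag mxblockK ifN //; apply: contraNneq nij => ->.
  exact: arrow_refl.
- by apply/fc_predP => i j nij; rewrite submxblockB hx // hy // subr0.
- apply/fc_predP => i j nij; rewrite -[x]submxblockK -[y]submxblockK.
  rewrite [_ * _]mul_mxblock mxblockK big1 // => k _.
  case: (boolP (arrow i k)) => [ik|/hx->]; last by rewrite mul0mx.
  rewrite hy ?mulmx0 //; apply: contra nij; exact: arrow_trans.
Qed.

Lemma fc_submod_closed : subsemimod_closed fc_pred.
Proof.
split=> [|a x /fc_predP hx].
  split=> [|x y /fc_predP hx /fc_predP hy]; apply/fc_predP => i j nij.
    by rewrite submxblock0.
  by rewrite submxblockD hx // hy // addr0.
by apply/fc_predP => i j nij; apply/matrixP => s t; move/matrixP: (hx i j nij)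
   => /(_ s t); rewrite !mxE => ->; rewrite mulr0.
Qed.

HB.instance Definition _ :=
  GRing.SubChoice_isSubPzRing.Build cstar fc_pred fcalg fc_subring_closed.
HB.instance Definition _ :=
  GRing.SubZmodule_isSubLmodule.Build R[i] cstar fc_pred fcalg fc_submod_closed.

Definition blkproj_mx (i : 'I_4) : cstar :=
  \mxdiag_(j < 4) (if j == i then 1%:M else 0).

Lemma blkproj_subproof i : blkproj_mx i \in fc_pred.
Proof.
apply/fc_predP => k l nkl; rewrite /blkproj_mx /mxdiag mxblockK ifN //.
by apply: contraNneq nkl => ->; exact: arrow_refl.
Qed.

Definition blkproj (i : 'I_4) : fcalg := FCAlg (blkproj_subproof i).

End FourCycleAlgebra.

Section Embeddings.
Variables (R : realType) (n n' : 'I_4 -> nat).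
Implicit Types (phi : {linear fcalg R n -> fcalg R n'}).
Implicit Types (Phi : {linear cstar R n -> cstar R n'}).

(* Homomorphisms are not required to preserve the unit.                       *)
Definition star_hom Phi : Prop :=
  {morph Phi : x y / x * y} /\ {morph Phi : x / x ^t*}.

Definition extends phi Phi : Prop :=
  forall a : fcalg R n, Phi (fc_val a) = fc_val (phi a).

Definition embedding phi : Prop :=
  {morph phi : a b / a * b} /\ injective phi.

Definition star_extendible phi : Prop :=
  embedding phi /\ exists Phi, star_hom Phi /\ extends phi Phi.

(* A *-homomorphism between full matrix algebras has multiplicity m when it   *)
(* sends minimal (rank one) projections to projections of rank m.             *)
Definition cstar_multiplicity Phi (m : nat) : Prop :=
  forall p : cstar R n,
    p * p = p -> p ^t* = p -> \rank p = 1%N -> \rank (Phi p) = m.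

Definition multiplicity phi (m : nat) : Prop :=
  exists Phi, [/\ star_hom Phi, extends phi Phi & cstar_multiplicity Phi m].

(* The permutations of the four blocks preserving {1,2} and {3,4}, that is    *)
(* id, (12), (34) and (12)(34).                                               *)
Definition block_perm (theta : 'S_4) : Prop :=
  forall i, (theta i < 2)%N = (i < 2)%N.

Definition rigid_of_type phi (theta : 'S_4) : Prop :=
  [/\ star_extendible phi, multiplicity phi 1, block_perm theta &
      forall (i j : 'I_4) (a : fcalg R n), exists b : fcalg R n',
        phi (blkproj R n i * a * blkproj R n j) =
        blkproj R n' (theta i) * b * blkproj R n' (theta j)].

Definition rigid_sum phi m (psi : 'I_m -> {linear fcalg R n -> fcalg R n'})
    (theta : 'I_m -> 'S_4) : Prop :=
  [/\ forall t, rigid_of_type (psi t) (theta t),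
      forall s t, s != t -> forall a b, psi s a * psi t b = 0 &
      forall a, phi a = \sum_t psi t a].

Definition rigid phi : Prop :=
  star_extendible phi /\ exists m psi theta, @rigid_sum phi m psi theta.

Definition generic phi : Prop :=
  rigid phi /\ exists m psi theta, @rigid_sum phi m psi theta /\
    forall sigma, block_perm sigma -> exists t, theta t = sigma.

Definition perm12 : 'S_4 := tperm 0 1.
Definition perm34 : 'S_4 := tperm 2 3.

Definition type_degree m (theta : 'I_m -> 'S_4) : int :=
  #|[set t | theta t \in [set 1%g; (perm12 * perm34)%g]]|%:Z -
  #|[set t | theta t \in [set perm12; perm34]]|%:Z.

(* The integer by which H_1(phi) multiplies when phi is rigid; it does not    *)
(* depend on the chosen decomposition.                                        *)
Definition H1_degree phi : int :=
  xget 0 [set z | exists m psi theta,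
    @rigid_sum phi m psi theta /\ z = type_degree theta]%classic.

Definition H1_map phi (z : int) : int := H1_degree phi * z.

Lemma H1_map_is_additive phi : zmod_morphism (H1_map phi).
Proof. by move=> x y; rewrite /H1_map mulrBr. Qed.

HB.instance Definition _ phi :=
  GRing.isZmodMorphism.Build int int (H1_map phi) (H1_map_is_additive phi).

End Embeddings.

Record generic_system (R : realType) := GenericSystem {
  blocks : nat -> 'I_4 -> nat;
  blocks_gt0 : forall k i, (0 < blocks k i)%N;
  conn : forall k, {linear fcalg R (blocks k) -> fcalg R (blocks k.+1)};
  conn_generic : forall k, generic (conn k)
}.

Section GenericLimit.
Variables (R : realType) (S : generic_system R).

(* The extension of conn S k to the C*-algebras; it is unique since           *)
(* M_r(C) is generated as a *-algebra by the 4-cycle algebra.                 *)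
Definition cstar_conn k :
    {linear cstar R (blocks S k) -> cstar R (blocks S k.+1)} :=
  sval (cid (conn_generic S k).1.1.2).

Lemma cstar_connP k :
  star_hom (cstar_conn k) /\ extends (conn S k) (cstar_conn k).
Proof. exact: (svalP (cid (conn_generic S k).1.1.2)). Qed.

Definition lim_alg : lmodType R[i] := llim (conn S).

Definition lim_alg_mul : lim_alg -> lim_alg -> lim_alg :=
  @dl_op2 (fun k => fcalg R (blocks S k)) _ (fun k a b => a * b).

(* The algebraic direct limit of the algebras M_r(C) = C*(A_k).               *)
Definition lim_cstar : lmodType R[i] := llim cstar_conn.

Definition lim_cstar_mul : lim_cstar -> lim_cstar -> lim_cstar :=
  @dl_op2 (fun k => cstar R (blocks S k)) _ (fun k x y => x * y).

Definition lim_cstar_star : lim_cstar -> lim_cstar :=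
  @dl_map (fun k => cstar R (blocks S k)) (fun k => cstar R (blocks S k)) _ _
    (fun k (x : cstar R (blocks S k)) => x ^t*).

Definition lim_incl : lim_alg -> lim_cstar :=
  @dl_map (fun k => fcalg R (blocks S k)) (fun k => cstar R (blocks S k)) _ _
    (fun k (a : fcalg R (blocks S k)) => fc_val a).

Definition lim_H1 : zmodType := zlim (fun k => H1_map (conn S k)).

Lemma lim_alg_mulE k (a b : fcalg R (blocks S k)) :
  lim_alg_mul (llim_inj (conn S) a) (llim_inj (conn S) b) =
  llim_inj (conn S) (a * b).
Proof.
rewrite /lim_alg_mul /llim_inj /zlim_inj dl_op2E // => j x y.
exact: (conn_generic S j).1.1.1.1.
Qed.

Lemma lim_cstar_mulE k (x y : cstar R (blocks S k)) :
  lim_cstar_mul (llim_inj cstar_conn x) (llim_inj cstar_conn y) =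
  llim_inj cstar_conn (x * y).
Proof.
rewrite /lim_cstar_mul /llim_inj /zlim_inj dl_op2E // => j u v.
exact: (cstar_connP j).1.1.
Qed.

Lemma lim_cstar_starE k (x : cstar R (blocks S k)) :
  lim_cstar_star (llim_inj cstar_conn x) = llim_inj cstar_conn (x ^t*).
Proof.
rewrite /lim_cstar_star /llim_inj /zlim_inj dl_mapE // => j u.
exact/esym/(cstar_connP j).1.2.
Qed.

Lemma lim_inclE k (a : fcalg R (blocks S k)) :
  lim_incl (llim_inj (conn S) a) = llim_inj cstar_conn (fc_val a).
Proof.
rewrite /lim_incl /llim_inj /zlim_inj dl_mapE // => j u.
exact/esym/(cstar_connP j).2.
Qed.

End GenericLimit.

Section StarExtendibleIsomorphism.
Variables (R : realType) (S S' : generic_system R).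

Definition alg_iso (phi : {linear lim_alg S -> lim_alg S'}) : Prop :=
  bijective phi /\
  forall a b, phi (lim_alg_mul a b) = lim_alg_mul (phi a) (phi b).

Definition star_iso (Phi : {linear lim_cstar S -> lim_cstar S'}) : Prop :=
  [/\ bijective Phi,
      forall x y, Phi (lim_cstar_mul x y) = lim_cstar_mul (Phi x) (Phi y) &
      forall x, Phi (lim_cstar_star x) = lim_cstar_star (Phi x)].

Definition star_extendibly_isomorphic : Prop :=
  exists phi : {linear lim_alg S -> lim_alg S'}, alg_iso phi /\
  exists Phi : {linear lim_cstar S -> lim_cstar S'}, star_iso Phi /\
    forall a, Phi (lim_incl a) = lim_incl (phi a).

End StarExtendibleIsomorphism.

Definition zmod_isomorphic (G G' : zmodType) : Prop :=
  exists g : {additive G -> G'}, bijective g.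

(* Main.v *)
Require Import Defs.
From HB Require Import structures.
From mathcomp Require Import all_boot all_order all_algebra all_fingroup.
From mathcomp Require Import complex spectral boolp classical_sets reals.

(* Let F : A -> A' be a star extendible embedding of multiplicity m between   *)
(* 4-cycle algebras.  In terms of C*(A) (x) M_m, the projections F(Q_i) Q'_a  *)
(* are Q_i (x) p_i^a with p_i^a projections of M_m, and                       *)
(*        deg F = tr ((p_1^1 - p_2^1) (p_3^3 - p_4^3))                        *)
(* extends to all F the integer attached to rigid embeddings.  When the p_i^a *)
(* vanish unless i and a are both in {1,2} or both in {3,4}, deg (G F) is the *)
(* product of deg F and deg G, because the projections of a composite are     *)
(* sums of tensors p_i^b (x) q_b^a.                                           *)
(* A star extendible isomorphism of limits yields embeddings between finite   *)
(* stages which need not be rigid, but can be followed by another embedding   *)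
(* to give a composite of rigid maps.  Then P = p_1^1 - p_2^1 and             *)
(* Q = p_3^3 - p_4^3 are forced to be symmetries, and since P (x) P' and      *)
(* Q (x) Q' commute, P and Q either commute, in which case the embedding is   *)
(* rigid, or anticommute, in which case tr (P Q) = 0.  Either way the degree  *)
(* is an integer, so multiplication by degrees gives mutually inverse maps    *)
(* between the limit groups.                                                  *)

Set Implicit Arguments.
Unset Strict Implicit.
Unset Printing Implicit Defensive.

Import Order.TTheory GRing.Theory Num.Theory.
Local Open Scope ring_scope.
Local Open Scope sesquilinear_scope.

(** A star extendible isomorphism of the limits carries each finite stage into a finite stage of the
    other system ([exists_lift]). These lifts intertwine the two systems, but need not be rigid, so
    no map on H_1 comes with them. [degree] replaces it. On a sum of rigid maps it is the signed
    count of types, whatever the decomposition ([rigid_sum_degree]). It is multiplicative when the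
    first map respects the pairs of blocks {1,2} and {3,4} ([degree_comp]). If G F is rigid-like and
    nonzero, then F respects the pairs ([factor_upper]) and has integer degree ([factor_degree]).

    A lift of the isomorphism followed by one of its inverse is a composite of connecting maps, so
    all this applies to lifts. Multiplication by their degrees is compatible with the connecting
    maps ([lift_push]); [H1_rel] is thus the graph of an additive map, and the inverse isomorphism
    yields the converse relation ([H1_rel_sym]). *)

(** Indices carry their block number, and the section [base] keeps every block nonempty. Entrywise
    arguments thereby avoid matrices of dependent block sizes; [lab] is the concrete instance. *)
Record labelling := Labelling {
  dim : nat;
  blk : 'I_dim -> 'I_4;
  base : 'I_4 -> 'I_dim;
  baseK : cancel base (@blk) }.
Arguments blk {l}.
Arguments base {l}.
Arguments baseK : clear implicits.

(** * Matrix units and block projections *)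

Section MatrixUnits.
Variable C : numClosedFieldType.
Local Notation M X := 'M[C]_(dim X).

Definition munit (X : labelling) (s t : 'I_(dim X)) : M X := delta_mx s t.

Definition bproj (X : labelling) (a : 'I_4) : M X :=
  \matrix_(s, t) ((s == t) && (blk s == a))%:R.

Definition fcmx (X : labelling) (x : M X) : Prop :=
  forall s t, ~~ arrow (blk s) (blk t) -> x s t = 0.

Variable X : labelling.
Implicit Types (s t : 'I_(dim X)) (x y : M X).

Lemma scale_mulAl a x y : a *: (x * y) = (a *: x) * y.
Proof. exact: scalemxAl. Qed.

Lemma scale_mulAr a x y : a *: (x * y) = x * (a *: y).
Proof. exact: scalemxAr. Qed.

Lemma trace_mulC x y : \tr (x * y) = \tr (y * x).
Proof. exact: mxtrace_mulC. Qed.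

Lemma munitM s t s' t' :
  munit s t * munit s' t' = (munit s t' : M X) *+ (t == s').
Proof. exact: mul_delta_mx_cond. Qed.

Lemma munitMx s t t' : munit s t * munit t t' = munit s t'.
Proof. by rewrite munitM eqxx. Qed.

Lemma munit_star s t : (munit s t) ^t* = munit t s.
Proof. by apply/matrixP => i j; rewrite !mxE andbC rmorph_nat. Qed.

Lemma mx_munit x : x = \sum_s \sum_t x s t *: munit s t.
Proof. exact: matrix_sum_delta. Qed.

Lemma sum_munit : \sum_s munit s s = 1 :> M X.
Proof.
apply/matrixP => i j; rewrite summxE (bigD1 i) //= big1 ?addr0 => [|k ki].
  by rewrite !mxE eqxx eq_sym.
by rewrite !mxE eq_sym (negPf ki).
Qed.

Lemma munitMM s t s' t' x : munit s t * x * munit s' t' = x t s' *: munit s t'.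
Proof.
apply/matrixP => i j; rewrite !mxE (bigD1 s') //= big1 ?addr0 => [|k ks].
  rewrite !mxE eqxx (bigD1 t) //= big1 ?addr0 => [|k kt].
    rewrite !mxE !eqxx /= andbT.
    by case: (i == s); rewrite !(mul1r, mul0r, mulr0).
  by rewrite !mxE (negPf kt) andbF mul0r.
by rewrite !mxE (negPf ks) mulr0.
Qed.

Lemma sum_bproj : \sum_a bproj X a = 1.
Proof.
apply/matrixP => i j; rewrite summxE (bigD1 (blk i)) //= big1 => [|k ki].
  by rewrite addr0 !mxE eqxx andbT.
by rewrite !mxE [blk i == k]eq_sym (negPf ki) andbF.
Qed.

Lemma bprojMl a x s t : (bproj X a * x) s t = x s t *+ (blk s == a).
Proof.
rewrite mxE (bigD1 s) //= big1 ?addr0 => [|k ks].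
  by rewrite !mxE eqxx; case: eqP; rewrite ?(mul1r, mul0r).
by rewrite !mxE eq_sym (negPf ks) mul0r.
Qed.

Lemma bprojMr a x s t : (x * bproj X a) s t = x s t *+ (blk t == a).
Proof.
rewrite mxE (bigD1 t) //= big1 ?addr0 => [|k ks].
  by rewrite !mxE eqxx; case: eqP; rewrite ?(mulr1, mulr0).
by rewrite !mxE (negPf ks) mulr0.
Qed.

Lemma bprojM a b : bproj X a * bproj X b = bproj X a *+ (a == b).
Proof.
apply/matrixP => s t; rewrite bprojMr !mxE mulmxnE !mxE.
by case: (s =P t) => [<-|_]; rewrite ?mul0rn //; case: (blk s =P a) => [->|];
  rewrite ?mul0rn.
Qed.

Lemma bproj_munit a s t : bproj X a * munit s t = munit s t *+ (blk s == a).
Proof.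
apply/matrixP => i j; rewrite bprojMl mulmxnE !mxE.
by case: (i =P s) => [->|]; rewrite ?mul0rn.
Qed.

Lemma munit_fc s t : arrow (blk s) (blk t) -> fcmx (munit s t).
Proof.
move=> st i j nij; rewrite mxE; case: eqP => //= ei; case: eqP => //= ej.
by rewrite ei ej st in nij.
Qed.

Lemma fcmx_bproj x a b : fcmx x -> ~~ arrow a b -> bproj X a * x * bproj X b = 0.
Proof.
move=> Ax nab; apply/matrixP => s t; rewrite bprojMr bprojMl mxE.
case: eqP => [et|_] //; case: eqP => [es|_] //; rewrite Ax //.
by rewrite es et.
Qed.

(* A matrix of the algebra whose adjoint is in the algebra is block diagonal. *)
Lemma fcmx_diag x a : fcmx x -> fcmx (x ^t*) -> x * bproj X a = bproj X a * x.
Proof.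
move=> Ax Ax'; apply/matrixP => s t; rewrite bprojMr bprojMl.
case: (eqVneq (blk s) (blk t)) => [->//|nst].
suff -> : x s t = 0 by rewrite !mul0rn.
have [st|/Ax//] := boolP (arrow (blk s) (blk t)).
have: (x ^t*) t s = 0.
  apply: Ax'; move: st; rewrite /arrow (negPf nst) eq_sym (negPf nst) /=.
  by case/andP => s2 t2; rewrite ltnNge t2.
by rewrite !mxE => /eqP; rewrite conjC_eq0 => /eqP.
Qed.

End MatrixUnits.
Arguments bproj {C X}.
Arguments munit {C X}.

(** * Star homomorphisms and the projections of their multiplicity space *)

Section Homs.
Variable C : numClosedFieldType.
Local Notation M X := 'M[C]_(dim X).

Record fc_hom (X Y : labelling) (F : M X -> M Y) : Prop := FcHom {
  homD : {morph F : x y / x + y};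
  homZ : forall a, {morph F : x / a *: x};
  homM : {morph F : x y / x * y};
  homS : {morph F : x / x ^t*};
  homA : forall x, fcmx x -> fcmx (F x) }.

(* Under an identification of M X (x) M m with a corner of M Y through which  *)
(* F is x |-> x (x) 1, these are the projections 1 (x) p, p in M m, with      *)
(* F e * bproj a = e (x) p for the diagonal unit e at the base of block i.    *)
Definition mproj (X Y : labelling) (F : M X -> M Y) (i a : 'I_4) : M Y :=
  \sum_s F (munit s (base i)) * bproj a * F (munit (base i) s).

Definition mdiff X Y (F : M X -> M Y) (i j : 'I_4) : M Y :=
  mproj F i i - mproj F j i.

(** The factor F of a diagonal unit restricts the trace to one copy of the multiplicity space. *)
Definition degree X Y (F : M X -> M Y) : C :=
  \tr (F (munit (base 0) (base 0)) * (mdiff F 0 1 * mdiff F 2 3)).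

Definition upper_bounded X Y (F : M X -> M Y) : Prop :=
  forall i a : 'I_4, (i < 2)%N != (a < 2)%N -> mproj F i a = 0.

(* Unlike rigidity itself, this is plainly stable under composition. *)
Record rigid_like X Y (F : M X -> M Y) : Prop := RigidLike {
  rl_upper : upper_bounded F;
  rl_compl12 : mproj F 0 0 + mproj F 1 0 = F 1;
  rl_compl34 : mproj F 2 2 + mproj F 3 2 = F 1;
  rl_comm : mdiff F 0 1 * mdiff F 2 3 = mdiff F 2 3 * mdiff F 0 1 }.

Section OneHom.
Variables (X Y : labelling) (F : M X -> M Y).
Hypothesis hF : fc_hom F.

Lemma hom0 : F 0 = 0.
Proof. by have := homZ hF 0 0; rewrite !scale0r. Qed.

Lemma homN x : F (- x) = - F x.
Proof. by rewrite -scaleN1r (homZ hF) scaleN1r. Qed.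

Lemma homB x y : F (x - y) = F x - F y.
Proof. by rewrite (homD hF) homN. Qed.

Lemma hom_sum (I : Type) (r : seq I) (P : pred I) (G : I -> M X) :
  F (\sum_(i <- r | P i) G i) = \sum_(i <- r | P i) F (G i).
Proof. exact: (big_morph F (homD hF) hom0). Qed.

Lemma hom1l x : F 1 * F x = F x.
Proof. by rewrite -(homM hF) mul1r. Qed.

Lemma hom1r x : F x * F 1 = F x.
Proof. by rewrite -(homM hF) mulr1. Qed.

Lemma hom_munitM s t s' t' :
  F (munit s t) * F (munit s' t') = F (munit s t') *+ (t == s').
Proof. by rewrite -(homM hF) munitM; case: eqP => //; rewrite hom0. Qed.

Lemma hom_munitMx s t t' : F (munit s t) * F (munit t t') = F (munit s t').
Proof. by rewrite hom_munitM eqxx. Qed.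

Lemma hom_munitE x : F x = \sum_s \sum_t x s t *: F (munit s t).
Proof.
rewrite {1}(mx_munit x) hom_sum; apply: eq_bigr => s _.
by rewrite hom_sum; apply: eq_bigr => t _; rewrite (homZ hF).
Qed.

Lemma sum_hom_munit : \sum_s F (munit s s) = F 1.
Proof. by rewrite -hom_sum sum_munit. Qed.

Definition commutes (c : M Y) := forall x, F x * c = c * F x.

Lemma commutes_munit c :
  (forall s t, F (munit s t) * c = c * F (munit s t)) -> commutes c.
Proof.
move=> h x; rewrite hom_munitE mulr_suml mulr_sumr; apply: eq_bigr => s _.
rewrite mulr_suml mulr_sumr; apply: eq_bigr => t _.
by rewrite -scale_mulAl h scale_mulAr.
Qed.

Lemma munit_mproj i a s t : F (munit s t) * mproj F i a =
  F (munit s (base i)) * bproj a * F (munit (base i) t).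
Proof.
rewrite mulr_sumr (bigD1 t) //= big1 => [|k kt].
  by rewrite addr0 !mulrA hom_munitMx.
by rewrite !mulrA hom_munitM eq_sym (negPf kt) !mul0r.
Qed.

Lemma mproj_munit i a s t : mproj F i a * F (munit s t) =
  F (munit s (base i)) * bproj a * F (munit (base i) t).
Proof.
rewrite mulr_suml (bigD1 s) //= big1 => [|k kt].
  by rewrite addr0 -!mulrA hom_munitMx.
by rewrite -!mulrA hom_munitM (negPf kt) !mulr0.
Qed.

Lemma mproj_commutes i a : commutes (mproj F i a).
Proof. by apply: commutes_munit => s t; rewrite munit_mproj mproj_munit. Qed.

(** Both the unit and its adjoint lie in the algebra, so [fcmx_diag] applies to the image. *)
Lemma munit_bproj s t a : blk s = blk t ->
  F (munit s t) * bproj a = bproj a * F (munit s t).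
Proof.
move=> st; apply: fcmx_diag; [|rewrite -(homS hF) munit_star];
  by apply/(homA hF)/munit_fc; rewrite st arrow_refl.
Qed.

Lemma bproj_mproj i a : F (bproj i) * bproj a = F (bproj i) * mproj F i a.
Proof.
have -> : bproj i = \sum_(s | blk s == i) munit s s :> M X.
  rewrite -[LHS]mulr1 -sum_munit mulr_sumr [RHS]big_mkcond /=.
  by apply: eq_bigr => s _; rewrite bproj_munit; case: eqP.
rewrite hom_sum !mulr_suml; apply: eq_bigr => s /eqP si.
rewrite munit_mproj munit_bproj // -(hom_munitMx s (base i) s) mulrA.
by rewrite munit_bproj ?baseK.
Qed.

Lemma sum_mproj i : \sum_a mproj F i a = F 1.
Proof.
rewrite exchange_big /= -sum_hom_munit; apply: eq_bigr => s _.
by rewrite -mulr_suml -mulr_sumr sum_bproj mulr1 hom_munitMx.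
Qed.

Lemma mproj1r i a : mproj F i a * F 1 = mproj F i a.
Proof.
rewrite mulr_suml; apply: eq_bigr => s _.
by rewrite -!mulrA hom1r.
Qed.

Lemma mproj1l i a : F 1 * mproj F i a = mproj F i a.
Proof. by rewrite mproj_commutes mproj1r. Qed.

Lemma mprojMgen i j a b : mproj F i a * mproj F j b =
  \sum_s F (munit s (base i)) * (bproj a * F (munit (base i) (base j)) * bproj b)
    * F (munit (base j) s).
Proof.
rewrite mulr_suml; apply: eq_bigr => s _.
by rewrite -!mulrA munit_mproj !mulrA.
Qed.

Lemma mprojM i a b : mproj F i a * mproj F i b = mproj F i a *+ (a == b).
Proof.
rewrite mprojMgen -sumrMnl; apply: eq_bigr => s _.
rewrite -munit_bproj // -[X in _ * X * _]mulrA bprojM.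
by case: eqP => [_|_]; rewrite ?mulr1n ?mulr0n ?mulr0 ?mul0r // !mulrA hom_munitMx.
Qed.

(** The middle factor in [mprojMgen] is the (a, b) block of an element of the target algebra. *)
Lemma mproj_arrow i j a b : arrow i j -> ~~ arrow a b ->
  mproj F i a * mproj F j b = 0.
Proof.
move=> ij nab; rewrite mprojMgen big1 // => s _.
by rewrite fcmx_bproj ?mulr0 ?mul0r //; apply/(homA hF)/munit_fc; rewrite !baseK.
Qed.

(* F x * c stands for the tensor x (x) c. *)
Lemma hom_tensor x x' c c' : commutes c -> commutes c' ->
  F 1 * c = c -> F 1 * c' = c' -> F x * c = F x' * c' ->
  forall s t, x s t *: c = x' s t *: c'.
Proof.
(* Multiplying by matrix units on both sides and summing over k cuts out an entry of z as a
   scalar. *)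
have main (z : M X) d s t : commutes d -> F 1 * d = d ->
    z s t *: d = \sum_k F (munit k s) * (F z * d) * F (munit t k).
  move=> cd d1; transitivity (z s t *: (F 1 * d)); first by rewrite d1.
  rewrite -sum_hom_munit mulr_suml scaler_sumr; apply: eq_bigr => k _.
  rewrite -!mulrA -cd !mulrA -!(homM hF) munitMM (homZ hF).
  exact: scale_mulAl.
move=> cc cc' c1 c1' e s t.
by rewrite (main x c) // (main x' c') // e.
Qed.

Lemma hom_tensor0 x c : commutes c -> F 1 * c = c -> F x * c = 0 -> x = 0 \/ c = 0.
Proof.
move=> cc c1 e; have [->|c0] := eqVneq c 0; [by right|left].
have e' : F x * c = F 0 * c by rewrite e hom0 mul0r.
apply/matrixP => s t; have /eqP := hom_tensor cc cc c1 c1 e' s t.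
by rewrite !mxE scale0r scaler_eq0 (negPf c0) orbF => /eqP.
Qed.

Lemma hom_inj : F 1 != 0 -> injective F.
Proof.
move=> f0 x y e; have e0 : F (x - y) * F 1 = 0 by rewrite hom1r homB e subrr.
have c1 : commutes (F 1) by move=> z; rewrite hom1l hom1r.
case: (hom_tensor0 c1 (hom1r 1) e0) => [/eqP|f1]; first by rewrite subr_eq0 => /eqP.
by rewrite f1 eqxx in f0.
Qed.

Lemma trace_munit c s t v : commutes c ->
  \tr (F (munit s t) * c) = \tr (F (munit v v) * c) *+ (s == t).
Proof.
move=> cc; rewrite -(hom_munitMx s v t) -mulrA cc.
rewrite trace_mulC -mulrA hom_munitM eq_sym.
by case: eqP => _; rewrite ?mulr0 ?mxtrace0 // cc.
Qed.

Lemma trace_tensor x c v : commutes c ->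
  \tr (F x * c) = \tr x * \tr (F (munit v v) * c).
Proof.
move=> cc; rewrite hom_munitE mulr_suml raddf_sum [\tr x]/mxtrace mulr_suml.
apply: eq_bigr => s _; rewrite mulr_suml raddf_sum (bigD1 s) //= big1 => [|t ts].
  by rewrite addr0 -scale_mulAl mxtraceZ (trace_munit _ _ v) // eqxx.
by rewrite -scale_mulAl mxtraceZ (trace_munit _ _ v) // eq_sym (negPf ts) mulr0.
Qed.

End OneHom.
End Homs.

(** * Composition *)

Section Composition.
Variable C : numClosedFieldType.
Local Notation M X := 'M[C]_(dim X).

Lemma fc_hom_id X : fc_hom (@id (M X)).
Proof. by []. Qed.

Lemma fc_hom_comp X Y Z (F : M X -> M Y) (G : M Y -> M Z) :
  fc_hom F -> fc_hom G -> fc_hom (G \o F).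
Proof.
move=> hF hG; split => [x y|a x|x y|x|x Ax] /=.
- by rewrite (homD hF) (homD hG).
- by rewrite (homZ hF) (homZ hG).
- by rewrite (homM hF) (homM hG).
- by rewrite (homS hF) (homS hG).
- exact/(homA hG)/(homA hF).
Qed.

Lemma commutesM X Y (F : M X -> M Y) c d :
  commutes F c -> commutes F d -> commutes F (c * d).
Proof. by move=> hc hd x; rewrite mulrA hc -mulrA hd mulrA. Qed.

Lemma commutesD X Y (F : M X -> M Y) c d :
  commutes F c -> commutes F d -> commutes F (c + d).
Proof. by move=> hc hd x; rewrite mulrDl mulrDr hc hd. Qed.

Lemma commutesN X Y (F : M X -> M Y) c : commutes F c -> commutes F (- c).
Proof. by move=> hc x; rewrite mulNr mulrN hc. Qed.

Lemma commutes1 X Y (F : M X -> M Y) : fc_hom F -> commutes F (F 1).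
Proof. by move=> hF x; rewrite (hom1l hF) (hom1r hF). Qed.

Lemma mdiff_commutes X Y (F : M X -> M Y) i j :
  fc_hom F -> commutes F (mdiff F i j).
Proof. by move=> hF; apply/commutesD/commutesN; exact: mproj_commutes. Qed.

Lemma mdiff1l X Y (F : M X -> M Y) i j : fc_hom F -> F 1 * mdiff F i j = mdiff F i j.
Proof. by move=> hF; rewrite mulrBr !mproj1l. Qed.

Lemma mdiff1r X Y (F : M X -> M Y) i j : fc_hom F -> mdiff F i j * F 1 = mdiff F i j.
Proof. by move=> hF; rewrite mulrBl !mproj1r. Qed.

Definition pair_bounded X Y (F : M X -> M Y) (i j : 'I_4) : Prop :=
  i != j /\ forall a, a != i -> a != j -> mproj F i a = 0 /\ mproj F j a = 0.

Lemma upper_pair12 X Y (F : M X -> M Y) : upper_bounded F -> pair_bounded F 0 1.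
Proof.
by move=> uF; split=> // -[[|[|[|[|a]]]] ha] //= _ _; split; apply: uF.
Qed.

Lemma upper_pair34 X Y (F : M X -> M Y) : upper_bounded F -> pair_bounded F 2 3.
Proof.
by move=> uF; split=> // -[[|[|[|[|a]]]] ha] //= _ _; split; apply: uF.
Qed.

Section Pair.
Variables (X Y : labelling) (F : M X -> M Y) (i j : 'I_4).
Hypotheses (hF : fc_hom F) (bF : pair_bounded F i j).

Lemma pair_sum k : k \in [:: i; j] -> mproj F k i + mproj F k j = F 1.
Proof.
move=> kij; rewrite -(sum_mproj hF k) (bigD1 i) //= (bigD1 j) /=; last first.
  by rewrite eq_sym bF.1.
rewrite big1 ?addr0 // => a /andP[ai aj]; have [e1 e2] := bF.2 a ai aj.
by move: kij; rewrite !inE => /orP[]/eqP->.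
Qed.

Lemma pair_mproj k : k \in [:: i; j] -> mproj F k j = F 1 - mproj F k i.
Proof. by move=> /pair_sum<-; rewrite addrC addKr. Qed.

Lemma mdiff_sq : mproj F i i + mproj F j i = F 1 -> mdiff F i j * mdiff F i j = F 1.
Proof.
move=> e; have ej : mproj F j i = F 1 - mproj F i i by rewrite -e addrC addKr.
have e0 : mproj F i i * mproj F j i = 0.
  by rewrite ej mulrBr (mproj1r hF) (mprojM hF) eqxx subrr.
have e1 : mproj F j i * mproj F i i = 0.
  by rewrite ej mulrBl (mproj1l hF) (mprojM hF) eqxx subrr.
rewrite mulrBl !mulrBr e0 e1 !(mprojM hF) eqxx !mulr1n.
by rewrite subr0 sub0r opprK e.
Qed.
End Pair.

Section Comp.
Variables (X Y Z : labelling) (F : M X -> M Y) (G : M Y -> M Z).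
Hypotheses (hF : fc_hom F) (hG : fc_hom G).

(** Insert the sum of the block projections of Y, then apply [bproj_mproj] to G. *)
Lemma mproj_comp i j :
  mproj (G \o F) i j = \sum_a G (mproj F i a) * mproj G a j.
Proof.
transitivity (\sum_a \sum_s G (F (munit s (base i)) * bproj a *
    F (munit (base i) s)) * mproj G a j); last first.
  by apply: eq_bigr => a _; rewrite (hom_sum hG) mulr_suml.
rewrite exchange_big /=; apply: eq_bigr => s _ /=.
rewrite -[F (munit s (base i)) in LHS]mulr1 -sum_bproj mulr_sumr (hom_sum hG).
rewrite !mulr_suml; apply: eq_bigr => a _.
rewrite (homM hG) -[X in X * _ = _]mulrA (bproj_mproj hG).
by rewrite -!mulrA -(mproj_commutes hG) !mulrA !(homM hG).
Qed.

Lemma tensorM x y c d : commutes G c -> G x * c * (G y * d) = G (x * y) * (c * d).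
Proof. by move=> cc; rewrite (homM hG) -!mulrA (mulrA c) -cc -!mulrA. Qed.

Lemma mproj_comp_pair i j k : pair_bounded F i j -> k \in [:: i; j] ->
  mproj (G \o F) k i =
  G (mproj F k i) * mproj G i i + G (F 1 - mproj F k i) * mproj G j i.
Proof.
move=> bF kij; rewrite mproj_comp (bigD1 i) //= (bigD1 j) /=; last first.
  by rewrite eq_sym bF.1.
rewrite big1 ?addr0 => [|a /andP[ai aj]].
  by rewrite (pair_mproj hF bF).
have [e1 e2] := bF.2 a ai aj.
by move: kij; rewrite !inE => /orP[]/eqP->; rewrite ?e1 ?e2 (hom0 hG) mul0r.
Qed.

(** In the difference the unit terms cancel, leaving (p_i - p_j) (x) q_i + (p_j - p_i) (x) q_j. *)
Lemma mdiff_comp i j : pair_bounded F i j ->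
  mdiff (G \o F) i j = G (mdiff F i j) * mdiff G i j.
Proof.
move=> bF; rewrite /mdiff !(mproj_comp_pair bF) ?inE ?eqxx ?orbT //.
rewrite !(homB hG) !mulrBl !mulrBr !opprD !opprK.
rewrite [LHS]addrACA [RHS]addrACA; congr (_ + _).
by rewrite addrACA subrr add0r.
Qed.

Lemma degree_comp : upper_bounded F -> degree (G \o F) = degree F * degree G.
Proof.
move=> uF; have b12 := upper_pair12 uF; have b34 := upper_pair34 uF.
rewrite /degree (mdiff_comp b12) (mdiff_comp b34) tensorM; last exact: mdiff_commutes.
rewrite /= mulrA -(homM hG).
rewrite (trace_tensor hG _ (base 0)) //.
by apply: commutesM; apply: mdiff_commutes.
Qed.

Lemma upper_comp : upper_bounded F -> upper_bounded G -> upper_bounded (G \o F).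
Proof.
move=> uF uG i a ia; rewrite mproj_comp big1 // => b _.
have [ib|ib] := boolP ((i < 2)%N == (b < 2)%N); last first.
  by rewrite uF ?(hom0 hG) ?mul0r.
by rewrite uG ?mulr0 // -(eqP ib).
Qed.

Lemma pair_compl_comp i j : pair_bounded F i j ->
  mproj F i i + mproj F j i = F 1 -> mproj G i i + mproj G j i = G 1 ->
  mproj (G \o F) i i + mproj (G \o F) j i = (G \o F) 1.
Proof.
move=> bF eF eG; rewrite !(mproj_comp_pair bF) ?inE ?eqxx ?orbT //=.
rewrite addrACA -!mulrDl -!(homD hG) eF.
have -> : F 1 - mproj F i i + (F 1 - mproj F j i) = F 1.
  by rewrite addrACA -opprD eF addrK.
by rewrite -mulrDr eG (hom1r hG).
Qed.

Lemma rigid_like_comp : rigid_like F -> rigid_like G -> rigid_like (G \o F).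
Proof.
move=> [uF F12 F34 cF] [uG G12 G34 cG].
have b12 := upper_pair12 uF; have b34 := upper_pair34 uF.
split; [exact: upper_comp | exact: pair_compl_comp | exact: pair_compl_comp |].
rewrite (mdiff_comp b12) (mdiff_comp b34).
by rewrite !tensorM ?cF ?cG //; exact: mdiff_commutes.
Qed.

Hypothesis GF1 : G (F 1) != 0.

Lemma comp1_neq0 : F 1 != 0 /\ G 1 != 0.
Proof.
split; apply: contraNneq GF1 => e; first by rewrite e (hom0 hG).
by rewrite -(hom1l hG) e mul0r.
Qed.

(** Multiplying [mproj_comp] by [G (mproj F i a)] isolates one tensor, and a zero tensor has a zero
    factor. *)
Lemma factor_orth i j a : mproj (G \o F) i j = 0 -> mproj F i a = 0 \/ mproj G a j = 0.
Proof.
move=> e; apply: (hom_tensor0 hG); [exact: mproj_commutes | exact: mproj1l |].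
have := congr1 (fun x => G (mproj F i a) * x) e.
rewrite mulr0 => <-; rewrite mproj_comp mulr_sumr (bigD1 a) //= big1 => [|b ba].
  by rewrite addr0 mulrA -(homM hG) (mprojM hF) eqxx.
by rewrite mulrA -(homM hG) (mprojM hF) eq_sym (negPf ba) (hom0 hG) mul0r.
Qed.

(** The only arrow out of a block of {3,4}, or into a block of {1,2}, is its loop. Hence p_i^a =
    p_i^a p_j^a in the first case and p_j^a = p_i^a p_j^a in the second. *)
Lemma mproj_le (i j a : 'I_4) : (i < 2)%N -> (2 <= j)%N ->
  ((2 <= a)%N -> mproj F j a = 0 -> mproj F i a = 0) /\
  ((a < 2)%N -> mproj F i a = 0 -> mproj F j a = 0).
Proof.
move=> i2 j2; have ij : arrow i j by rewrite /arrow i2 j2 orbT.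
split=> a2 e.
- rewrite -(mproj1r hF) -(sum_mproj hF j) mulr_sumr big1 // => b _.
  have [->|ba] := eqVneq b a; first by rewrite e mulr0.
  apply: (mproj_arrow hF ij); rewrite /arrow eq_sym (negPf ba) /=.
  by rewrite ltnNge a2.
- rewrite -(mproj1l hF) -(sum_mproj hF i) mulr_suml big1 // => b _.
  have [->|ba] := eqVneq b a; first by rewrite e mul0r.
  apply: (mproj_arrow hF ij); rewrite /arrow (negPf ba) /=.
  by rewrite [(2 <= a)%N]leqNgt a2 andbF.
Qed.

Lemma factor_upper : upper_bounded (G \o F) -> upper_bounded F.
Proof.
move=> uGF; have [_ G1] := comp1_neq0.
(* Otherwise [factor_orth] kills every q_a^b, through i for b in {3,4} and through j for b in {1,2};
   but these sum to G 1. *)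
have key (i j a : 'I_4) : (i < 2)%N -> (2 <= j)%N ->
    mproj F i a != 0 -> mproj F j a != 0 -> False.
  move=> i2 j2 pi pj; case/negP: G1; rewrite -(sum_mproj hG a); apply/eqP.
  apply: big1 => b _; have [b2|b2] := leqP 2 b.
  - have ib : (i < 2)%N != (b < 2)%N by rewrite i2 [(b < 2)%N]ltnNge b2.
    by case: (factor_orth a (uGF i b ib)) => // /eqP; rewrite (negPf pi).
  - have jb : (j < 2)%N != (b < 2)%N by rewrite b2 [(j < 2)%N]ltnNge j2.
    by case: (factor_orth a (uGF j b jb)) => // /eqP; rewrite (negPf pj).
move=> i a; have [i2|i2] := leqP 2 i; have [a2|a2] := leqP 2 a => //= _;
  apply/eqP/negPn/negP => p0.
- apply: (key 0 i a) => //; apply: contraNneq p0 => e.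
  by rewrite ((@mproj_le 0 i a isT i2).2 a2 e).
- apply: (key i 2 a) => //; apply: contraNneq p0 => e.
  by rewrite ((@mproj_le i 2 a i2 isT).1 a2 e).
Qed.
End Comp.
End Composition.

(** * Factors of rigid composites *)

(** In a rank factorization e = K L, idempotence forces L K = 1, and tr (K L) = tr (L K). *)
Lemma trace_idempotent (C : fieldType) n (e : 'M[C]_n) :
  e *m e = e -> \tr e = (\rank e)%:R.
Proof.
move=> ee; have := mulmx_base e.
have := @row_full_inj _ _ _ n _ (col_base_full e).
have := @row_free_inj _ _ (\rank e) _ _ (row_base_free e).
move: (col_base e) (row_base e) => K L Linj Kinj KL.
have LK : L *m K = 1%:M.
  by apply/Linj/Kinj; rewrite !mulmxA KL mulmx1 KL -mulmxA KL.
by rewrite -[in LHS]KL mxtrace_mulC LK mxtrace1.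
Qed.

Section Factor.
Variable C : numClosedFieldType.
Local Notation M X := 'M[C]_(dim X).
Variables (X Y Z : labelling) (F : M X -> M Y) (G : M Y -> M Z).
Hypotheses (hF : fc_hom F) (hG : fc_hom G) (GF1 : G (F 1) != 0).

Lemma tensor_neq0 c : commutes G c -> G 1 * c = c -> G (F 1) * c = 0 -> c = 0.
Proof.
move=> cc c1 e; have [F1 _] := comp1_neq0 hG GF1.
by case: (hom_tensor0 hG cc c1 e) => // /eqP; rewrite (negPf F1).
Qed.

Lemma addrr_id (x : M Z) : x + x = x -> x = 0.
Proof. by move=> /(canRL (addrK x)); rewrite subrr. Qed.

(* With s = p1 + p2, the hypothesis on the composite is the tensor identity   *)
(* s (x) q1 + (2 - s) (x) q2 = 1 (x) 1.  Compressing it between q1 and 1 - q1 *)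
(* shows that q1 and q2 commute; multiplying by q1 q2, q1 and q2 then gives   *)
(* q1 q2 = 0 and s = 1.                                                       *)
Lemma factor_compl i j : pair_bounded F i j ->
  mproj (G \o F) i i + mproj (G \o F) j i = (G \o F) 1 ->
  mproj F i i + mproj F j i = F 1 /\ mproj G i i + mproj G j i = G 1.
Proof.
move=> bF; rewrite !(mproj_comp_pair hF hG bF) ?inE ?eqxx ?orbT //=.
rewrite addrACA -!mulrDl -!(homD hG).
set s := mproj F i i + mproj F j i; set q1 := mproj G i i; set q2 := mproj G j i.
set f := F 1; set s' := _ + _ : M Y => e.
have ss' : s + s' = f + f.
  by rewrite /s' /s addrACA !(addrC (mproj F _ _)) !subrK.
have c1 : commutes G q1 := mproj_commutes hG i i.
have c2 : commutes G q2 := mproj_commutes hG j i.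
have u1 : G 1 * q1 = q1 := mproj1l hG i i.
have u2 : G 1 * q2 = q2 := mproj1l hG j i.
have v1 : q1 * G 1 = q1 := mproj1r hG i i.
have v2 : q2 * G 1 = q2 := mproj1r hG j i.
have i1 : q1 * q1 = q1 by rewrite (mprojM hG) eqxx.
have i2 : q2 * q2 = q2 by rewrite (mprojM hG) eqxx.
have cGf c : commutes G c -> c * G f = G f * c by move=> cc; rewrite cc.
(* Otherwise s = 2 and 2 (x) q1 = 1 (x) 1; multiplying by q1 forces G f = 0. *)
have s'0 : s' != 0.
  apply/eqP => s'0; move: e ss'; rewrite s'0 (hom0 hG) mul0r !addr0 => e es.
  have e1 : G f * q1 = G f by rewrite -e -mulrA i1.
  move: e; rewrite es (homD hG) mulrDl e1 => /addrr_id.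
  exact/eqP.
have c1' : commutes G (G 1 - q1).
  by apply/commutesD/commutesN => //; exact: commutes1.
have q1d : q1 * (G 1 - q1) = 0 by rewrite mulrBr v1 i1 subrr.
have dq1 : (G 1 - q1) * q1 = 0 by rewrite mulrBl u1 i1 subrr.
have c12 := commutesM c1 c2.
have h1 : q1 * q2 = q1 * q2 * q1.
  suff: q1 * q2 * (G 1 - q1) = 0.
    by move=> /eqP; rewrite mulrBr subr_eq0 -(mulrA q1 q2 (G 1)) v2 => /eqP.
  have e0 : G s' * (q1 * q2 * (G 1 - q1)) = 0.
    have := congr1 (fun x => q1 * x * (G 1 - q1)) e.
    rewrite cGf // -[in RHS]mulrA q1d mulr0 => <-.
    rewrite (mulrDr q1) mulrDl !mulrA -c1 -!mulrA q1d !mulr0 add0r.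
    by rewrite !mulrA c1.
  have [|/eqP|//] := hom_tensor0 hG (commutesM c12 c1') _ e0.
    by rewrite !mulrA u1.
  by rewrite (negPf s'0).
have h2 : q2 * q1 = q1 * q2 * q1.
  suff: (G 1 - q1) * q2 * q1 = 0.
    by move=> /eqP; rewrite !mulrBl subr_eq0 u2 => /eqP.
  have e0 : G s' * ((G 1 - q1) * q2 * q1) = 0.
    have := congr1 (fun x => (G 1 - q1) * x * q1) e.
    rewrite cGf // -[in RHS]mulrA dq1 mulr0 => <-.
    rewrite (mulrDr (G 1 - q1)) mulrDl !mulrA -!c1' -(mulrA (G s)) dq1 mulr0 mul0r.
    by rewrite add0r.
  have [|/eqP|//] := hom_tensor0 hG (commutesM (commutesM c1' c2) c1) _ e0.
    by rewrite !mulrA mulrBr (hom1l hG) u1.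
  by rewrite (negPf s'0).
have q12 : q1 * q2 = q2 * q1 by rewrite h1 h2.
have z12 : q1 * q2 = 0.
  apply: tensor_neq0 => //; first by rewrite mulrA u1.
  apply: addrr_id; rewrite -mulrDl -(homD hG) -ss' (homD hG) mulrDl.
  have := congr1 (fun x => x * (q1 * q2)) e; rewrite mulrDl => <-.
  by rewrite -!mulrA !(mulrA q1) i1 q12 !mulrA -!(mulrA _ q2 q2) i2.
have e1 : G (s - f) * q1 = 0.
  have := congr1 (fun x => x * q1) e; rewrite mulrDl -!mulrA i1 -q12 z12 mulr0.
  by rewrite addr0 (homB hG) mulrBl => ->; rewrite subrr.
have e2 : G (s' - f) * q2 = 0.
  have := congr1 (fun x => x * q2) e; rewrite mulrDl -!mulrA i2 z12 mulr0.
  by rewrite add0r (homB hG) mulrBl => ->; rewrite subrr.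
(* By [e], q1 and q2 cannot both vanish; whichever survives gives s = f. *)
have sf : s = f.
  have [/eqP|q10] := hom_tensor0 hG c1 u1 e1; first by rewrite subr_eq0 => /eqP.
  have [/eqP|q20] := hom_tensor0 hG c2 u2 e2.
    by rewrite subr_eq0 => /eqP e'; move: ss'; rewrite e' => /addIr.
  by case/eqP: GF1; rewrite -/f -e q10 q20 !mulr0 addr0.
split=> //; apply/eqP; rewrite -subr_eq0; apply/eqP; apply: tensor_neq0.
- by apply/commutesD/commutesN; [exact: commutesD | exact: commutes1].
- by rewrite mulrBr mulrDr u1 u2 (hom1l hG).
have s'f : s' = f by move: ss'; rewrite sf => /addrI.
have e' : G f * q1 + G f * q2 = G f by rewrite -[RHS]e sf s'f.
by rewrite mulrBr mulrDr (hom1r hG) e' subrr.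
Qed.

(* With P and Q the symmetries of the two pairs of blocks, the composite being *)
(* rigid says that P (x) P' and Q (x) Q' commute, so that P Q is proportional  *)
(* to Q P; as P and Q are involutions they commute or anticommute.             *)
Lemma factor_mdiff : rigid_like (G \o F) ->
  let P := mdiff F 0 1 in let Q := mdiff F 2 3 in
  [/\ P * P = F 1, Q * Q = F 1 & P * Q = Q * P \/ P * Q = - (Q * P)].
Proof.
move=> [uGF e12 e34 eGF] P Q.
have uF := factor_upper hF hG GF1 uGF.
have b12 := upper_pair12 uF; have b34 := upper_pair34 uF.
have [eF12 eG12] := factor_compl b12 e12.
have [eF34 eG34] := factor_compl b34 e34.
have PP : P * P = F 1 := mdiff_sq hF eF12.
have QQ : Q * Q = F 1 := mdiff_sq hF eF34.
have P1 : P * F 1 = P := mdiff1r 0 1 hF.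
have Q1 : Q * F 1 = Q := mdiff1r 2 3 hF.
split=> //; move: eGF; rewrite !(mdiff_comp hF hG b12) !(mdiff_comp hF hG b34).
rewrite -/P -/Q; set P' := mdiff G 0 1; set Q' := mdiff G 2 3.
have cP : commutes G P' by exact: mdiff_commutes.
have cQ : commutes G Q' by exact: mdiff_commutes.
have GP : G 1 * P' = P' := mdiff1l 0 1 hG.
have GQ : G 1 * Q' = Q' := mdiff1l 2 3 hG.
rewrite !tensorM // => /(hom_tensor hG (commutesM cP cQ) (commutesM cQ cP)).
rewrite !mulrA GP GQ => /(_ erefl erefl) e.
(* P' and Q' square to G 1, so their product is invertible in that corner. *)
have /matrix0Pn[u [v nz]] : P' * Q' != 0.
  have [_] := comp1_neq0 hG GF1; apply: contraNneq => e0.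
  rewrite -[G 1](mdiff_sq hG eG12) -/P' -{1}[P'](mdiff1r 0 1 hG).
  by rewrite -(mdiff_sq hG eG34) -/Q' !mulrA e0 !mul0r.
pose l := (Q' * P') u v / (P' * Q') u v.
have PQ : P * Q = l *: (Q * P).
  apply/matrixP => s t; rewrite [RHS]mxE; apply: (mulIf nz).
  have := congr1 (fun x : M Z => x u v) (e s t).
  by rewrite [LHS]mxE [in RHS]mxE => ->; rewrite mulrAC divfK // mulrC.
have PQP : P * Q * P = l *: Q.
  by rewrite PQ -scale_mulAl -mulrA PP Q1.
(* P Q P equals l Q and squares to F 1. *)
have : (l ^+ 2 - 1) *: F 1 = 0.
  rewrite scalerBl scale1r expr2 -scalerA -{1}QQ scale_mulAl scale_mulAr -PQP.
  by rewrite -!mulrA (mulrA P P) PP (mulrA Q _ (Q * P)) Q1 (mulrA Q Q) QQ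
    (mulrA P (F 1)) P1 PP subrr.
move/eqP; rewrite scaler_eq0 (negPf (comp1_neq0 hG GF1).1) orbF subr_eq0 sqrf_eq1.
by case/orP => /eqP l1; move: PQ; rewrite l1 ?scaleN1r ?scale1r; [left|right].
Qed.

(** If P and Q anticommute, the trace vanishes by cyclicity. If they commute, W = P Q is a symmetry
    and tr (E W) is the rank of E minus twice that of N, the part of E where W is -1. *)
Lemma factor_degree : rigid_like (G \o F) -> exists d : int, degree F = d%:~R.
Proof.
move=> rGF; have [PP QQ] := factor_mdiff rGF.
have hP := mdiff_commutes 0 1 hF; have hQ := mdiff_commutes 2 3 hF.
rewrite /degree; set E := F (munit _ _).
move: hP hQ PP QQ (mdiff1r 0 1 hF) (mdiff1r 2 3 hF).
move: (mdiff F 0 1) (mdiff F 2 3) => P Q hP hQ PP QQ P1 Q1.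
have EE : E * E = E by rewrite /E hom_munitMx.
have PE : E * P = P * E := hP _; have QE : E * Q = Q * E := hQ _.
case=> PQ; last first.
  exists 0; suff : \tr (E * (P * Q)) = - \tr (E * (P * Q)).
    by move=> /eqP; rewrite -addr_eq0 -mulr2n mulrn_eq0 /= => /eqP.
  rewrite {1}PQ mulrN linearN /=; congr (- _).
  rewrite (mulrA E Q P) (trace_mulC (E * Q)) (mulrA P E Q) -PE.
  by rewrite -mulrA.
have hW : E * (P * Q) = P * Q * E by rewrite mulrA PE -mulrA QE mulrA.
have WW : P * Q * (P * Q) = F 1.
  by rewrite {2}PQ -mulrA (mulrA Q) QQ mulrA P1 PP.
have E1 : E * F 1 = E by rewrite (hom1r hF).
move: (P * Q) hW WW => W hW WW.
pose N := 2^-1 *: (E - E * W).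
have NN : N *m N = N.
  have EWE : E * W * E = E * W by rewrite hW -mulrA EE.
  have : (E - E * W) * (E - E * W) = 2 *: (E - E * W).
    rewrite mulrBr !mulrBl EE EWE mulrA EE mulrA EWE -mulrA WW E1 opprB.
    by rewrite scaler_nat mulr2n.
  move=> N2; rewrite /N -scalemxAl -scalemxAr [_ *m _]N2.
  by rewrite !scalerA -mulrA mulVf ?pnatr_eq0 // mulr1.
exists ((\rank E)%:Z - (\rank N)%:Z *+ 2).
rewrite rmorphB rmorphMn /= -!pmulrn -(trace_idempotent EE) -(trace_idempotent NN).
rewrite -raddfMn -raddfB /= -scaler_nat scalerA divff ?pnatr_eq0 // scale1r.
by rewrite opprB addrC subrK.
Qed.

End Factor.

(** * Orthogonal sums of rigid maps of multiplicity one *)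

Lemma block_perm_val (s : 'S_4) : block_perm s ->
  ((s 0 = 0 /\ s 1 = 1) \/ (s 0 = 1 /\ s 1 = 0)) /\
  ((s 2 = 2 /\ s 3 = 3) \/ (s 2 = 3 /\ s 3 = 2)).
Proof.
move=> bs; have lo (a : 'I_4) : (a < 2)%N -> a = 0 \/ a = 1.
  by case: a => -[|[|a]] ha //= _; [left|right]; apply: val_inj.
have hi (a : 'I_4) : (a < 2)%N = false -> a = 2 \/ a = 3.
  by case: a => -[|[|[|[|a]]]] ha //= _; [left|right]; apply: val_inj.
have inj i j : s i = s j -> i = j by apply: perm_inj.
split.
- have [e0|e0] := lo _ (bs 0); have [e1|e1] := lo _ (bs 1); auto;
    by have := inj 0 1; rewrite e0 e1 => /(_ erefl).
- have [e0|e0] := hi _ (bs 2); have [e1|e1] := hi _ (bs 3); auto;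
    by have := inj 2 3; rewrite e0 e1 => /(_ erefl).
Qed.

Lemma block_perm_eq (s t : 'S_4) : block_perm s -> block_perm t ->
  (s == t) = (s 0 == t 0) && (s 2 == t 2).
Proof.
move=> /block_perm_val[s01 s23] /block_perm_val[t01 t23].
apply/eqP/andP => [->//|[/eqP e0 /eqP e2]]; apply/permP => -[[|[|[|[|i]]]] hi] //.
- by rewrite (_ : Ordinal hi = 0) //; apply: val_inj.
- rewrite (_ : Ordinal hi = 1); last exact: val_inj.
  by case: s01 t01 e0 => -[-> ->] [] [-> ->].
- by rewrite (_ : Ordinal hi = 2) //; apply: val_inj.
- rewrite (_ : Ordinal hi = 3); last exact: val_inj.
  by case: s23 t23 e2 => -[-> ->] [] [-> ->].
Qed.

Lemma block_perm1 : block_perm 1.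
Proof. by move=> i; rewrite perm1. Qed.

Lemma block_perm12 : block_perm perm12.
Proof. by move=> i; rewrite /perm12; case: tpermP => [->|->|]. Qed.

Lemma block_perm34 : block_perm perm34.
Proof. by move=> i; rewrite /perm34; case: tpermP => [->|->|]. Qed.

Lemma block_perm1234 : block_perm (perm12 * perm34)%g.
Proof. by move=> i; rewrite permM block_perm34 block_perm12. Qed.

(** What a rigid summand of type s contributes to the degree: the product of the signs of s on {1,2}
    and on {3,4}. *)
Definition block_sign (s : 'S_4) : int :=
  ((s 0 == 0)%:Z - (s 1 == 0)%:Z) * ((s 2 == 2)%:Z - (s 3 == 2)%:Z).

Lemma block_signE s : block_perm s ->
  block_sign s = (s \in [set 1%g; (perm12 * perm34)%g])%:Z -
                 (s \in [set perm12; perm34])%:Z.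
Proof.
move=> bs; rewrite !inE !block_perm_eq //; try exact: block_perm1;
  try exact: block_perm12; try exact: block_perm34; try exact: block_perm1234.
rewrite /block_sign !permM !perm1 /perm12 /perm34.
have [[[-> ->]|[-> ->]] [[-> ->]|[-> ->]]] := block_perm_val bs;
by rewrite !permE.
Qed.

Lemma type_degreeE m (theta : 'I_m -> 'S_4) : (forall t, block_perm (theta t)) ->
  type_degree theta = \sum_t block_sign (theta t).
Proof.
move=> bth; rewrite (eq_bigr _ (fun t _ => block_signE (bth t))) sumrB.
have card (B : {set 'S_4}) : #|[set t | theta t \in B]|%:Z =
    \sum_t (theta t \in B)%:Z.
  rewrite -sum1_card (big_morph Posz PoszD (erefl _)) big_mkcond /=.
  by apply: eq_bigr => t _; rewrite inE; case: ifP.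
by rewrite -!card.
Qed.

Section RigidSum.
Variable C : numClosedFieldType.
Local Notation M X := 'M[C]_(dim X).
Variables (X Y : labelling) (m : nat) (F : M X -> M Y) (G : 'I_m -> M X -> M Y).
Variable theta : 'I_m -> 'S_4.
Hypothesis hG : forall t, fc_hom (G t).
Hypothesis bth : forall t, block_perm (theta t).
Hypothesis Gth : forall t i,
  G t (bproj i) * bproj (theta t i) = G t (bproj i).
Hypothesis FG : forall x, F x = \sum_t G t x.
Hypothesis orthG : forall s t, s != t -> forall x y, G s x * G t y = 0.

Lemma summand_bproj t i a s :
  G t (munit s (base i)) * bproj a =
  G t (munit s (base i)) *+ (theta t i == a).
Proof.
have e : munit s (base i) = munit s (base i) * bproj i :> M X.
  rewrite -[LHS]mulr1 -sum_bproj mulr_sumr (bigD1 i) //= big1 ?addr0 // => b bi.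
  apply/matrixP => j k; rewrite bprojMr !mxE; case: (k =P base i) => [->|_].
    by rewrite baseK [i == b]eq_sym (negPf bi).
  by rewrite andbF mul0rn.
rewrite e (homM (hG t)) -Gth -!mulrA bprojM.
by case: (_ == a); rewrite ?mulr1n ?mulr0n ?mulr0.
Qed.

(** Every p_i^a is a sum of some of the mutually orthogonal G t 1, so all later computations are
    diagonal in t. *)
Lemma sum_mproj_rigid i a :
  mproj F i a = \sum_t G t 1 *+ (theta t i == a).
Proof.
transitivity (\sum_t \sum_s G t (munit s s) *+ (theta t i == a)); last first.
  by apply: eq_bigr => t _; rewrite sumrMnl (sum_hom_munit (hG t)).
rewrite exchange_big /=; apply: eq_bigr => s _.
rewrite !FG mulr_suml mulr_suml; apply: eq_bigr => t _.
rewrite summand_bproj mulr_sumr (bigD1 t) //= big1 => [|t' tt'].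
  by rewrite addr0 mulrnAl (hom_munitMx (hG t)).
by rewrite mulrnAl orthG ?mul0rn // eq_sym.
Qed.

Lemma mdiff_rigid i j :
  mdiff F i j = \sum_t ((theta t i == i)%:R - (theta t j == i)%:R) *: G t 1.
Proof.
rewrite /mdiff !sum_mproj_rigid -sumrB; apply: eq_bigr => t _.
by rewrite scalerBl !scaler_nat.
Qed.

Lemma sum_scaleM (c d : 'I_m -> C) x y :
  (\sum_t c t *: G t x) * (\sum_t d t *: G t y) = \sum_t (c t * d t) *: G t (x * y).
Proof.
rewrite mulr_suml; apply: eq_bigr => t _; rewrite mulr_sumr (bigD1 t) //= big1.
  by rewrite addr0 -scale_mulAr -scale_mulAl scalerA (homM (hG t)) mulrC.
by move=> s st; rewrite -scale_mulAr -scale_mulAl orthG 1?eq_sym // !scaler0.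
Qed.

Lemma rigid_like_sum : rigid_like F.
Proof.
split.
- move=> i a ia; rewrite sum_mproj_rigid big1 // => t _.
  by case: eqP => // e; move: ia; rewrite -e bth eqxx.
- rewrite !sum_mproj_rigid -big_split FG; apply: eq_bigr => t _ /=.
  by have [[[-> ->]|[-> ->]] _] := block_perm_val (bth t); rewrite ?addr0 ?add0r.
- rewrite !sum_mproj_rigid -big_split FG; apply: eq_bigr => t _ /=.
  by have [_ [[-> ->]|[-> ->]]] := block_perm_val (bth t); rewrite ?addr0 ?add0r.
- by rewrite !mdiff_rigid !sum_scaleM; apply: eq_bigr => t _; rewrite mulrC.
Qed.

Hypothesis traceG : forall t, \tr (G t (munit (base 0) (base 0))) = 1.

Lemma degree_sum : degree F = (type_degree theta)%:~R.
Proof.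
rewrite /degree !mdiff_rigid sum_scaleM FG.
rewrite (eq_bigr (fun t => 1 *: G t (munit (base 0) (base 0)))); last first.
  by move=> t _; rewrite scale1r.
rewrite (sum_scaleM (fun=> 1)) raddf_sum type_degreeE // rmorph_sum /=.
apply: eq_bigr => t _; rewrite linearZ /= !mulr1 traceG mulr1 mul1r.
by rewrite rmorphM !rmorphB /= -!pmulrn.
Qed.
End RigidSum.

(** * The 4-cycle algebras *)

Section Uniqueness.
Variable C : numClosedFieldType.
Local Notation M X := 'M[C]_(dim X).

(* A 4-cycle algebra generates the full matrix algebra as a *-algebra. *)
Lemma fc_hom_ext X Y (F F' : M X -> M Y) : fc_hom F -> fc_hom F' ->
  (forall x, fcmx x -> F x = F' x) -> F =1 F'.
Proof.
move=> hF hF' FF' x; rewrite (hom_munitE hF) (hom_munitE hF').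
pose good s t := F (munit s t) = F' (munit s t).
have garrow s t : arrow (blk s) (blk t) -> good s t.
  by move=> st; apply/FF'/munit_fc.
have gtrans s t u : good s t -> good t u -> good s u.
  by move=> st tu; rewrite /good -!(munitMx _ s t u) (homM hF) (homM hF') st tu.
have gsym s t : good s t -> good t s.
  have e : munit t s = (munit s t) ^t* :> M X by rewrite munit_star.
  by move=> st; rewrite /good e (homS hF) (homS hF') st.
have arrow_cond (i j : 'I_4) : [|| arrow i j, arrow j i, (i < 2)%N && (j < 2)%N |
    (2 <= i)%N && (2 <= j)%N].
  by rewrite /arrow; case: (leqP 2 i); case: (leqP 2 j); rewrite ?orbT.
have g s t : good s t.
  (* Indices in the same pair are joined through a base index of the other pair, using an
     adjoint. *)
  case/or4P: (arrow_cond (blk s) (blk t)) => [|/garrow/gsym//|/andP[s2 t2]|/andP[s2 t2]].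
  - exact: garrow.
  - apply: (gtrans _ (base 2)); first by apply: garrow; rewrite baseK /arrow s2 orbT.
    by apply/gsym/garrow; rewrite baseK /arrow t2 orbT.
  - apply: (gtrans _ (base 0)); last by apply: garrow; rewrite baseK /arrow t2 orbT.
    by apply/gsym/garrow; rewrite baseK /arrow s2 orbT.
by apply: eq_bigr => s _; apply: eq_bigr => t _; rewrite [F _]g.
Qed.

Lemma fc_hom_sum X Y m (G : 'I_m -> M X -> M Y) : (forall t, fc_hom (G t)) ->
  (forall s t, s != t -> forall x y, G s x * G t y = 0) ->
  fc_hom (fun x => \sum_t G t x).
Proof.
move=> hG oG; split=> [x y|a x|x y|x|x Ax] /=.
- by rewrite -big_split; apply: eq_bigr => t _; rewrite (homD (hG t)).
- by rewrite scaler_sumr; apply: eq_bigr => t _; rewrite (homZ (hG t)).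
- rewrite mulr_suml; apply: eq_bigr => t _; rewrite mulr_sumr (bigD1 t) //= big1.
    by rewrite addr0 (homM (hG t)).
  by move=> s st; rewrite oG // eq_sym.
- apply/matrixP => i j; rewrite !mxE !summxE rmorph_sum /=.
  by apply: eq_bigr => t _; rewrite (homS (hG t)) !mxE.
- by move=> i j nij; rewrite summxE big1 // => t _; exact: (homA (hG t)).
Qed.
End Uniqueness.

Section FourCycle.
Variable R : realType.

Definition lab (n : 'I_4 -> nat) (n0 : forall i, (0 < n i)%N) : labelling :=
  @Labelling (\sum_i n i) (@tagnat.sig1 4 n)
    (fun i => tagnat.Rank i (Ordinal (n0 i))) (fun i => tagnat.Rank1K (Ordinal (n0 i))).

Section One.
Variables (n : 'I_4 -> nat) (n0 : forall i, (0 < n i)%N).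
Local Notation X := (lab n0).

Lemma fcmxP (x : cstar R n) : reflect (@fcmx R[i] X x) (x \in fc_pred (n := n)).
Proof.
apply: (iffP (fc_predP _)) => [h s t nst | h i j nij].
  have /matrixP/(_ (tagnat.sig2 s) (tagnat.sig2 t)) := h _ _ nst.
  by rewrite !mxE !tagnat.sig2K.
by apply/matrixP => s t; rewrite !mxE; apply: h; rewrite /= !tagnat.Rank1K.
Qed.

Lemma blkprojE i : blkproj_mx R n i = @bproj R[i] X i.
Proof.
apply/mxblockP => k l; rewrite /blkproj_mx /mxdiag mxblockK.
case: (eqVneq k l) => [<-|kl]; apply/matrixP => s t.
  rewrite conform_mx_id [RHS]mxE [RHS]mxE /= tagnat.Rank1K.
  rewrite (inj_eq (@tagnat.rank_inj _ _)) eq_Tagged /=.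
  by case: eqP => _; rewrite !mxE ?andbT ?andbF.
rewrite [LHS]mxE [RHS]mxE [RHS]mxE /=; case: eqP => // e.
have := congr1 tagnat.sig1 e; rewrite !tagnat.Rank1K => /eqP.
by rewrite (negPf kl).
Qed.

End One.
Section Two.
Variables (n n' : 'I_4 -> nat).
Variables (n0 : forall i, (0 < n i)%N) (n0' : forall i, (0 < n' i)%N).
Local Notation X := (lab n0).
Local Notation Y := (lab n0').
Local Notation Mx X := 'M[R[i]]_(dim X).
Implicit Types (phi : {linear fcalg R n -> fcalg R n'}).
Implicit Types (Phi : {linear cstar R n -> cstar R n'}).

Lemma fc_hom_extends phi Phi : star_hom Phi -> extends phi Phi ->
  fc_hom (Phi : Mx X -> Mx Y).
Proof.
move=> [hM hS] ext; split=> [x y|a x|x y|x|x /(fcmxP n0) Ax].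
- exact: (linearD Phi).
- exact: (linearZZ Phi).
- exact: hM.
- exact: hS.
- apply/(fcmxP n0'); have -> : x = fc_val (FCAlg Ax) by [].
  by rewrite ext; exact: fc_valP.
Qed.

(** The extensions of the summands are orthogonal because their units are, and uniqueness of
    extensions makes Phi their sum. As [degree] depends on Phi alone, all decompositions have the
    same type degree. *)
Lemma rigid_sum_degree phi Phi m psi theta : star_hom Phi -> extends phi Phi ->
  @rigid_sum R n n' phi m psi theta ->
  @rigid_like _ X Y Phi /\ @degree _ X Y Phi = (type_degree theta)%:~R.
Proof.
move=> sPhi ePhi [rpsi opsi sumpsi].
have [G hGt] := choice (fun t => let: And4 _ h _ _ := rpsi t in h).
have hG t : @fc_hom _ X Y (G t) by case: (hGt t) => s e _; exact: fc_hom_extends s e.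
have val1 t : G t 1 = fc_val (psi t 1) by case: (hGt t) => _ e _; rewrite -e.
have oG s t : s != t -> forall x y : Mx X, (G s x : Mx Y) * (G t y : Mx Y) = 0.
  move=> st x y; rewrite -(hom1r (hG s)) -(hom1l (hG t)) -mulrA (mulrA (G s 1 : Mx Y)).
  have -> : (G s 1 : Mx Y) * (G t 1 : Mx Y) = 0.
    rewrite !val1; exact: (congr1 (@fc_val R n') (opsi s t st 1 1)).
  by rewrite mul0r mulr0.
have hPhi := fc_hom_extends sPhi ePhi.
have FG : (Phi : Mx X -> Mx Y) =1 (fun x => \sum_t G t x).
  apply: (fc_hom_ext hPhi (fc_hom_sum hG oG)) => x /(fcmxP n0) Ax.
  have -> : x = fc_val (FCAlg Ax) by [].
  rewrite ePhi sumpsi [LHS](big_morph (@fc_val R n') (fun _ _ => erefl) erefl).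
  by apply: eq_bigr => t _; case: (hGt t) => _ e _; rewrite -e.
have bth t : block_perm (theta t) by case: (rpsi t).
have Gth t i : (G t (bproj i : Mx X) : Mx Y) * bproj (theta t i) = G t (bproj i : Mx X).
  have [_ _ _ /(_ i i 1)[b hb]] := rpsi t.
  have [_ e _] := hGt t.
  have -> : (bproj i : Mx X) = fc_val (blkproj R n i * 1 * blkproj R n i).
    rewrite mulr1; apply: esym; rewrite [LHS]/= [LHS](_ : _ = (bproj i : Mx X) * bproj i).
      by rewrite bprojM eqxx.
    by rewrite -blkprojE.
  rewrite e hb; set q := blkproj R n' _.
  have -> : fc_val (q * b * q) = (bproj (theta t i) : Mx Y) * fc_val b * bproj (theta t i).
    by rewrite -blkprojE.
  by rewrite -mulrA bprojM eqxx.
have tG t : \tr (G t (munit (base 0) (base 0) : Mx X) : Mx Y) = 1.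
  have [sG _ mG] := hGt t; set E := munit _ _ : Mx X.
  have EE : E * E = E by rewrite munitMx.
  rewrite trace_idempotent; last by rewrite [LHS](esym (homM (hG t) E E)) EE.
  have EsE : E ^t* = E by rewrite munit_star.
  by rewrite [\rank _](mG E EE EsE (mxrank_delta _ _ _)).
split; first exact: (rigid_like_sum hG bth Gth FG oG).
exact: (degree_sum hG bth Gth FG oG tG).
Qed.

Lemma generic_degree phi Phi : generic phi -> star_hom Phi -> extends phi Phi ->
  @rigid_like _ X Y Phi /\ @degree _ X Y Phi = (H1_degree phi)%:~R.
Proof.
move=> [[_ [m [psi [theta rs]]]] _] sPhi ePhi; split.
  exact: (rigid_sum_degree sPhi ePhi rs).1.
rewrite /H1_degree; case: xgetP => [z _ [m' [psi' [theta' [rs' ->]]]]|].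
  exact: (rigid_sum_degree sPhi ePhi rs').2.
(* The default 0 of [xget] is excluded by the given decomposition. *)
by move=> /(_ (type_degree theta))[]; exists m, psi, theta.
Qed.

Lemma extends_neq0 phi Phi : embedding phi -> extends phi Phi ->
  (Phi (1 : Mx X) : Mx Y) != 0.
Proof.
move=> [_ iphi] ePhi; apply/eqP => e; have e1 : phi 1 = phi 0.
  by apply: val_inj; rewrite /= -!ePhi [LHS]e linear0.
have := congr1 (fun a : fcalg R n => (fc_val a : Mx X) (base 0) (base 0)) (iphi _ _ e1).
by rewrite !mxE eqxx => /eqP; rewrite oner_eq0.
Qed.

End Two.
End FourCycle.

(** * Finite stages of a generic system *)

Section Identity.
Variable C : numClosedFieldType.
Local Notation M X := 'M[C]_(dim X).

Lemma rigid_like_id X : rigid_like (@id (M X)) /\ degree (@id (M X)) = 1.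
Proof.
pose G (_ : 'I_1) := @id (M X).
have hG t : fc_hom (G t) by exact: fc_hom_id.
have bth (t : 'I_1) : block_perm 1 by exact: block_perm1.
have Gth (t : 'I_1) i : G t (bproj i) * bproj ((1%g : 'S_4) i) = G t (bproj i).
  by rewrite perm1 bprojM eqxx.
have FG x : id x = \sum_t G t x by rewrite big_ord_recl big_ord0 addr0.
have oG (s t : 'I_1) : s != t -> forall x y, G s x * G t y = 0.
  by rewrite !ord1 eqxx.
split; first exact: (rigid_like_sum hG bth Gth FG oG).
rewrite (degree_sum hG bth Gth FG oG).
  by rewrite type_degreeE // big_ord_recl big_ord0 /block_sign !perm1.
move=> t; rewrite /mxtrace (bigD1 (base 0)) //= big1 => [|s s0].
  by rewrite addr0 mxE eqxx.
by rewrite mxE (negPf s0).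
Qed.
End Identity.

Section System.
Variables (R : realType) (S : generic_system R).

Definition stage k : labelling := lab (blocks_gt0 S k).
Local Notation M k := 'M[R[i]]_(dim (stage k)).

Definition iota k (x : M k) : lim_cstar S := llim_inj (cstar_conn S) x.
Definition H1_inj k (z : int) : lim_H1 S :=
  @zlim_inj (fun _ => int) (fun k => H1_map (conn S k)) k z.
Definition push m k : M k -> M (m + k) :=
  @dl_push (fun k => cstar R (blocks S k)) (fun k => cstar_conn S k) m k.
Definition H1_push m k : int -> int :=
  @dl_push (fun _ => int) (fun k => H1_map (conn S k)) m k.

Lemma conn_hom k : @fc_hom _ (stage k) (stage k.+1) (cstar_conn S k).
Proof. by have [s e] := cstar_connP S k; exact: fc_hom_extends s e. Qed.

Lemma push_hom m k : fc_hom (@push m k).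
Proof.
elim: m => [|m IH]; first exact: fc_hom_id.
exact: (fc_hom_comp IH (conn_hom (m + k))).
Qed.

Lemma push_inj m k : injective (@push m k).
Proof.
elim: m => [//|m IH] x y /= /(hom_inj (conn_hom _)) e.
apply/IH/e; have [_ h] := cstar_connP S (m + k).
exact: (extends_neq0 _ _ (conn_generic S (m + k)).1.1.1 h).
Qed.

Lemma iota_push m k x : iota (@push m k x) = iota x.
Proof. exact: (@dl_inj_push (fun k => cstar R (blocks S k)) (fun k => cstar_conn S k)). Qed.

Lemma H1_inj_push m k z : H1_inj (m + k) (@H1_push m k z) = H1_inj k z.
Proof. exact: (@dl_inj_push (fun _ => int) (fun k => H1_map (conn S k))). Qed.

Lemma iota_inj k : injective (@iota k).
Proof.
move=> x y /(@dl_inj_eq (fun k => cstar R (blocks S k)) (fun k => cstar_conn S k)).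
move=> [m [p e]]; have /= /addIn mp := congr1 tag e; subst p.
exact: (push_inj (eq_from_Tagged e)).
Qed.

(** Degrees and maps on H_1 both multiply along composites, so the agreement of [generic_degree]
    propagates. *)
Lemma push_degree m k : rigid_like (@push m k) /\
  exists2 d : int, degree (@push m k) = d%:~R & forall z, @H1_push m k z = d * z.
Proof.
elim: m => [|m [rm [d dm dz]]].
  have [r e] := rigid_like_id R[i] (stage k); split=> //.
  by exists 1; [exact: e | move=> z; rewrite mul1r].
have [s e] := cstar_connP S (m + k).
have [rc dc] := @generic_degree R _ _ (blocks_gt0 S (m + k)) (blocks_gt0 S (m + k).+1)
   _ _ (conn_generic S (m + k)) s e.
have hc := conn_hom (m + k).
split; first exact: (rigid_like_comp (push_hom m k) hc rm rc).
exists (H1_degree (conn S (m + k)) * d).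
  have := degree_comp (push_hom m k) hc (rl_upper rm).
  by rewrite dm dc mulrC -rmorphM.
by move=> z; rewrite -mulrA -dz.
Qed.

Lemma iotaD k (x y : M k) : iota (x + y) = iota x + iota y.
Proof. by rewrite /iota llim_addE. Qed.

Lemma iotaZ k a (x : M k) : iota (a *: x) = a *: iota x.
Proof. exact/esym/llim_scaleE. Qed.

Lemma iotaM k (x y : M k) : iota (x * y) = lim_cstar_mul (iota x) (iota y).
Proof. by rewrite /iota lim_cstar_mulE. Qed.

Lemma iota_star k (x : M k) : iota (x ^t*) = lim_cstar_star (iota x).
Proof. by rewrite /iota lim_cstar_starE. Qed.

Lemma iota_surj X : exists k (x : M k), X = iota x.
Proof. exact: dl_inj_surj. Qed.

Lemma lim_incl_iota a : exists k (x : M k), fcmx x /\ lim_incl a = iota x.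
Proof.
have [k [x ->]] := dl_inj_surj a.
exists k, (fc_val x); split; first by apply/fcmxP; exact: fc_valP.
by rewrite -/(zlim_inj _ _) -/(llim_inj _ _) lim_inclE.
Qed.

Lemma iota_lim_incl k (x : M k) : fcmx x -> exists a, iota x = lim_incl a.
Proof.
move=> /(fcmxP (blocks_gt0 S k)) Ax.
by exists (llim_inj (conn S) (FCAlg Ax)); rewrite lim_inclE.
Qed.

Lemma iota_lift k l (x : M k) : (k <= l)%N -> exists y : M l,
  iota y = iota x /\ (fcmx x -> fcmx y).
Proof.
move=> kl; rewrite -(subnK kl); exists (@push (l - k) k x).
by split; [exact: iota_push | exact: (homA (push_hom _ _))].
Qed.

Lemma H1_injD k x y : H1_inj k (x + y) = H1_inj k x + H1_inj k y.
Proof. exact/esym/zlim_addE. Qed.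

Lemma H1_surj2 X Y : exists k x y, X = H1_inj k x /\ Y = H1_inj k y.
Proof. exact: dl_inj_surj2. Qed.

Lemma H1_inj_eq k l x y : H1_inj k x = H1_inj l y -> exists m p,
  existT (fun=> int) (m + k)%N (@H1_push m k x) = existT _ (p + l)%N (@H1_push p l y).
Proof. by move=> /(@dl_inj_eq (fun _ => int) (fun k => H1_map (conn S k))). Qed.

End System.

(** * Isomorphisms of limits *)

Section Isomorphism.
Variable R : realType.

(* Both an isomorphism extending one of limit algebras and its inverse have   *)
(* these properties.                                                          *)
Record lim_hom (S S' : generic_system R) (Phi : lim_cstar S -> lim_cstar S') :
    Prop := LimHom {
  lhD : {morph Phi : x y / x + y};
  lhZ : forall a, {morph Phi : x / a *: x};
  lhM : forall x y, Phi (lim_cstar_mul x y) = lim_cstar_mul (Phi x) (Phi y);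
  lhS : forall x, Phi (lim_cstar_star x) = lim_cstar_star (Phi x);
  lhA : forall a, exists b, Phi (lim_incl a) = lim_incl b }.

Local Notation M S k := 'M[R[i]]_(dim (stage S k)).

Record is_lift (S S' : generic_system R) (Phi : lim_cstar S -> lim_cstar S')
    k l (F : M S k -> M S' l) : Prop := IsLift {
  lift_hom : fc_hom F;
  liftE : forall x, iota (F x) = Phi (iota x) }.

(** The finitely many matrix units have images at a common stage beyond l0, those of the algebra
    being represented in the algebra. F extends this choice linearly; products and adjoints are
    checked in the limit, since [iota] is injective. *)
Lemma exists_lift S S' (Phi : lim_cstar S -> lim_cstar S') k l0 : lim_hom Phi ->
  exists l (F : M S k -> M S' l), (l0 <= l)%N /\ is_lift Phi F.
Proof.
move=> hPhi; pose I := 'I_(dim (stage S k)).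
pose good l (y : M S' l) (st : I * I) := iota y = Phi (iota (munit st.1 st.2 : M S k)) /\
  (arrow (blk st.1) (blk st.2) -> fcmx y).
have level (st : I * I) : exists l, exists y : M S' l, good l y st.
  have [ar|nar] := boolP (arrow (blk st.1) (blk st.2)); last first.
    have [l [y e]] := iota_surj (Phi (iota (munit st.1 st.2 : M S k))).
    by exists l, y; split; rewrite ?(negPf nar).
  have [a ea] := iota_lim_incl (munit_fc R[i] ar); rewrite /good ea.
  have [b ->] := lhA hPhi a.
  by have [l [y [Ay ->]]] := lim_incl_iota b; exists l, y.
have [lf hlf] := choice level.
pose l := maxn l0 (\max_st lf st); exists l.
have at_l (st : I * I) : exists y : M S' l, good l y st.
  have [y [e Ay]] := hlf st.
  have ll : (lf st <= l)%N by rewrite leq_max (leq_bigmax st) orbT.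
  have [y' [e' Ay']] := iota_lift y ll; exists y'.
  by split; [rewrite e' | move=> ar; apply/Ay'/Ay].
have [y hy] := choice at_l.
pose F (x : M S k) := \sum_s \sum_t x s t *: y (s, t).
exists F; split; first exact: leq_maxl.
have Phi0 : Phi 0 = 0 by have := lhZ hPhi 0 0; rewrite !scale0r.
have iota0 (T : generic_system R) j : iota (0 : M T j) = 0.
  by have := iotaZ 0 (0 : M T j); rewrite !scale0r.
have FE x : iota (F x) = Phi (iota x).
  rewrite {2}(mx_munit x) !(big_morph _ (@iotaD _ _ _) (iota0 _ _)).
  rewrite (big_morph _ (lhD hPhi) Phi0); apply: eq_bigr => s _.
  rewrite !(big_morph _ (@iotaD _ _ _) (iota0 _ _)) (big_morph _ (lhD hPhi) Phi0).
  apply: eq_bigr => t _; rewrite !iotaZ (lhZ hPhi); congr (_ *: _).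
  exact: (hy (s, t)).1.
split=> //; split=> [u v|a u|u v|u|u Au].
- by apply: iota_inj; rewrite iotaD !FE iotaD (lhD hPhi).
- by apply: iota_inj; rewrite iotaZ !FE iotaZ (lhZ hPhi).
- by apply: iota_inj; rewrite iotaM !FE iotaM (lhM hPhi).
- by apply: iota_inj; rewrite iota_star !FE iota_star (lhS hPhi).
- move=> i j nij; rewrite summxE big1 // => s _; rewrite summxE big1 // => t _.
  rewrite mxE; have [ar|nar] := boolP (arrow (blk s) (blk t)).
    by rewrite (hy (s, t)).2 // mulr0.
  by rewrite Au // mul0r.
Qed.

Section Inverse.
Variables (S S' : generic_system R).
Variables (Phi : lim_cstar S -> lim_cstar S') (Psi : lim_cstar S' -> lim_cstar S).
Hypotheses (hPhi : lim_hom Phi) (hPsi : lim_hom Psi) (PhiK : cancel Phi Psi).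

Lemma lift_comp k l m (F : M S k -> M S' l) (G : M S' l -> M S (m + k)) :
  is_lift Phi F -> is_lift Psi G -> G \o F = @push R S m k.
Proof.
move=> [_ FE] [_ GE]; apply: funext => x; apply: iota_inj.
by rewrite /= GE FE PhiK iota_push.
Qed.

Lemma lift_factor k l (F : M S k -> M S' l) : is_lift Phi F ->
  exists m (G : M S' l -> M S (m + k)), is_lift Psi G.
Proof.
move=> hF; have [k' [G [kk' hG]]] := exists_lift l k hPsi.
by exists (k' - k)%N; rewrite subnK //; exists G.
Qed.

(** A lift of the inverse completes F to a nonzero rigid-like [push], so the factor lemmas apply. *)
Lemma lift_degree k l (F : M S k -> M S' l) : is_lift Phi F ->
  upper_bounded F /\ exists d : int, degree F = d%:~R.
Proof.
move=> hF; have [m [G hG]] := lift_factor hF.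
have e := lift_comp hF hG; have [rp _] := push_degree S m k.
have GF1 : G (F 1) != 0.
  rewrite -/((G \o F) 1) e -(hom0 (push_hom S m k)) (inj_eq (@push_inj _ _ _ _)).
  apply/eqP => /matrixP/(_ (base 0) (base 0)); rewrite !mxE eqxx => /eqP.
  by rewrite oner_eq0.
have [hF' _] := hF; have [hG' _] := hG; rewrite -e in rp; split.
  exact: (factor_upper hF' hG' GF1 (rl_upper rp)).
exact: (factor_degree hF' hG' GF1 rp).
Qed.

(** The two routes from stage k into stage L agree, hence so do the products of degrees. Packing
    stage and integer in u lets two presentations of the same pair share one F'. *)
Lemma lift_push m k l L (F : M S k -> M S' l) (u : {_ : nat & int})
    (F' : M S (tag u) -> M S' L) (d d' z : int) :
  u = existT (fun=> int) (m + k)%N (@H1_push R S m k z) -> (l <= L)%N ->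
  is_lift Phi F -> degree F = d%:~R -> is_lift Phi F' -> degree F' = d'%:~R ->
  H1_inj S' l (d * z) = H1_inj S' L (d' * tagged u).
Proof.
move=> eu; rewrite {}eu /= in F' *.
move=> /subnK; move: (L - l)%N => q eL; rewrite -{}eL in F' *.
move=> hF dF hF' dF'.
have [rm [dm dmE dmz]] := push_degree S m k.
have [_ [dq dqE dqz]] := push_degree S' q l.
have e : @push R S' q l \o F = F' \o @push R S m k.
  apply: funext => x; apply: iota_inj.
  by rewrite /= iota_push (liftE hF) (liftE hF') iota_push.
have := degree_comp (lift_hom hF) (push_hom S' q l) (lift_degree hF).1.
rewrite e (degree_comp (push_hom S m k) (lift_hom hF') (rl_upper rm)).
rewrite dmE dF' dF dqE -!rmorphM => /intr_inj dd.
rewrite dmz mulrA [d' * dm]mulrC dd -(H1_inj_push S' q l) dqz.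
by rewrite mulrA [dq * d]mulrC.
Qed.

(** The graph of the induced map, formed from all lifts at all stages so that none is chosen. *)
Definition H1_rel (X : lim_H1 S) (Y : lim_H1 S') : Prop :=
  exists k l (F : M S k -> M S' l) (d z : int),
  [/\ is_lift Phi F, degree F = d%:~R, X = H1_inj S k z & Y = H1_inj S' l (d * z)].

(** Both lifts are compared with a third, from a stage where the sources agree to one beyond both
    targets. *)
Lemma H1_rel_fun X Y Y' : H1_rel X Y -> H1_rel X Y' -> Y = Y'.
Proof.
move=> [k [l [F [d [z [hF dF -> ->]]]]]] [k' [l' [F' [d' [z' [hF' dF' e ->]]]]]].
have [m [p]] := H1_inj_eq e; set u := existT _ _ _ => eu.
have [L [G [lL hG]]] := exists_lift (tag u) (maxn l l') hPhi.
have [_ [g dG]] := lift_degree hG.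
rewrite geq_max in lL; case/andP: lL => lL lL'.
rewrite (lift_push (erefl u) lL hF dF hG dG).
by rewrite (lift_push eu lL' hF' dF' hG dG).
Qed.

Lemma H1_rel_stage k : exists l (d : int), forall z : int,
  H1_rel (H1_inj S k z) (H1_inj S' l (d * z)).
Proof.
have [l [F [_ hF]]] := exists_lift k 0 hPhi.
have [_ [d dF]] := lift_degree hF.
by exists l, d => z; exists k, l, F, d, z.
Qed.

Lemma H1_rel_total X : exists Y, H1_rel X Y.
Proof.
have [k [z [_ [-> _]]]] := H1_surj2 X X; have [l [d h]] := H1_rel_stage k.
by exists (H1_inj S' l (d * z)).
Qed.

Lemma H1_relB X X' Y Y' : H1_rel X Y -> H1_rel X' Y' -> H1_rel (X - X') (Y - Y').
Proof.
have [k [z [z' [-> ->]]]] := H1_surj2 X X'; have [l [d h]] := H1_rel_stage k.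
move=> /(H1_rel_fun (h z)) <- /(H1_rel_fun (h z')) <-.
have H1B T j x y : H1_inj T j x - H1_inj T j y = H1_inj T j (x - y) :> lim_H1 T.
  by apply/eqP; rewrite subr_eq -H1_injD subrK.
by rewrite !H1B -mulrBr.
Qed.

End Inverse.

(** The lifts F and G compose to a [push] of degree d e, so G sends d z to the image of z at the
    later stage. *)
Lemma H1_rel_sym S S' (Phi : lim_cstar S -> lim_cstar S')
    (Psi : lim_cstar S' -> lim_cstar S) X Y : lim_hom Phi -> lim_hom Psi ->
  cancel Phi Psi -> cancel Psi Phi -> H1_rel Phi X Y -> H1_rel Psi Y X.
Proof.
move=> hPhi hPsi PhiK PsiK [k [l [F [d [z [hF dF -> ->]]]]]].
have [m [G hG]] := lift_factor hPsi hF.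
have [_ [e eG]] := lift_degree hPhi PsiK hG.
exists l, (m + k)%N, G, e, (d * z); split=> //.
have [rm [dm dmE dmz]] := push_degree S m k.
have := degree_comp (lift_hom hF) (lift_hom hG) (lift_degree hPsi PhiK hF).1.
rewrite (lift_comp PhiK hF hG) dmE dF eG -rmorphM => /intr_inj dd.
by rewrite -(H1_inj_push S m k) dmz dd mulrA [d * e]mulrC.
Qed.

Lemma lim_hom_isomorphic S S' (Phi : lim_cstar S -> lim_cstar S')
    (Psi : lim_cstar S' -> lim_cstar S) : lim_hom Phi -> lim_hom Psi ->
  cancel Phi Psi -> cancel Psi Phi -> zmod_isomorphic (lim_H1 S) (lim_H1 S').
Proof.
move=> hPhi hPsi PhiK PsiK.
have [g hg] := choice (H1_rel_total hPhi hPsi PhiK).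
have [g' hg'] := choice (H1_rel_total hPsi hPhi PsiK).
have gB : zmod_morphism g.
  move=> x y; apply: (H1_rel_fun hPhi hPsi PhiK (hg _)).
  exact: (H1_relB hPhi hPsi PhiK).
pose ga : {additive lim_H1 S -> lim_H1 S'} :=
  HB.pack g (GRing.isZmodMorphism.Build (lim_H1 S) (lim_H1 S') g gB).
exists ga; exists g' => x.
  apply: (H1_rel_fun hPsi hPhi PsiK (hg' _)).
  exact: (H1_rel_sym hPhi hPsi PhiK PsiK (hg x)).
apply: (H1_rel_fun hPhi hPsi PhiK (hg _)).
exact: (H1_rel_sym hPsi hPhi PsiK PhiK (hg' x)).
Qed.

End Isomorphism.

Theorem theorem3p3 (R : realType) (S S' : generic_system R)
    (iso : star_extendibly_isomorphic S S') :
  zmod_isomorphic (lim_H1 S) (lim_H1 S').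
Proof.
have [phi [[[phi' phiK phi'K] _] [Phi [[[Psi PhiK PsiK] PhiM PhiS] ext]]]] := iso.
apply: (@lim_hom_isomorphic R S S' Phi Psi) => //.
  by split=> // [x y|a x|a]; [exact: linearD | exact: linearZZ | exists (phi a)].
have iPhi := can_inj PhiK.
split=> [x y|a x|x y|x|a].
- by apply: iPhi; rewrite linearD !PsiK.
- by apply: iPhi; rewrite linearZZ !PsiK.
- by apply: iPhi; rewrite PhiM !PsiK.
- by apply: iPhi; rewrite PhiS !PsiK.
(* Psi extends the inverse of phi. *)
- by exists (phi' a); apply: iPhi; rewrite ext PsiK phi'K.
Qed.
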